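(* Let $E\subset\mathbb R^2$ be a Lalley-Gatzouras set with data $m$, $(n_i)$, $(b_i)$, $(a_{ij})$, $(c_{ij})$. Then $E$ is quasisymmetrically equivalent to the Cantor ternary set if and only if $E$ is totally disconnected and there exists an $i\in\{1,2,\dots,m\}$ such that $n_i=0$.
   Context: Lalley-Gatzouras sets. Let $m\ge 2$ and $n_i\ge 0$ ($i=1,\dots,m$) be integers. Let $b_i>0$ ($i=1,\dots,m$) be real numbers with $\sum_{i=1}^m b_i=1$. Put $d_1=0$ and $d_i=b_1+\dots+b_{i-1}$ for $2\le i\le m$. Let $\mathcal D=\{(i,j): 1\le i\le m,\ n_i>0,\ 1\le j\le n_i\}$, assumed nonempty. Let $(a_{ij})_{(i,j)\in\mathcal D}$ and $(c_{ij})_{(i,j)\in\mathcal D}$ be nonnegative real numbers such that $1>b_i>a_{ij}>0$ for each $(i,j)\in\mathcal D$; $\sum_{j=1}^{n_i}a_{ij}\le 1$ for each $i$; $c_{i(j+1)}-c_{ij}\ge a_{ij}$ whenever $(i,j),(i,j+1)\in\mathcal D$; and $1-c_{in_i}\ge a_{in_i}$ for each $i$ with $n_i>0$. For $(i,j)\in\mathcal D$ define $S_{ij}:\mathbb R^2\to\mathbb R^2$ by $S_{ij}(x,y)=(a_{ij}x+c_{ij},\,b_iy+d_i)$. The Lalley-Gatzouras set $E$ is the attractor of $\{S_{ij}\}_{(i,j)\in\mathcal D}$, i.e. the unique nonempty compact set with $E=\bigcup_{(i,j)\in\mathcal D}S_{ij}(E)$. Quasisymmetric equivalence. A mapping $f$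 from a metric space $(X,d)$ to a metric space $(Y,\rho)$ is quasisymmetric if it is an injection and there exists a homeomorphism $\eta:[0,\infty)\to[0,\infty)$ such that for any $x,y,z\in X$ and $t>0$, $d(x,y)\le t\,d(x,z)$ implies $\rho(f(x),f(y))\le\eta(t)\,\rho(f(x),f(z))$. Two metric spaces are quasisymmetrically equivalent if there is a quasisymmetric mapping from one onto the other. $E$ and the Cantor ternary set carry the Euclidean metric.
   Formalization: The index set D is assumed to have at least two elements; when D has exactly one element, E is a single point, so it is totally disconnected and some n_i = 0, yet it is not equivalent to the Cantor set, and the claim as stated fails. *)

(* Defs.v *)
From HB Require Import structures.
From mathcomp Require Import all_boot all_order all_algebra.
From mathcomp Require Import ring lra.
From mathcomp Require Import boolp classical_sets functions reals.
From mathcomp Require Import topology.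

Set Implicit Arguments.
Unset Strict Implicit.
Unset Printing Implicit Defensive.

Import Order.TTheory GRing.Theory Num.Theory.
Import numFieldTopology.Exports.

Local Open Scope classical_set_scope.
Local Open Scope ring_scope.

(* The library's metric on [R * R] is the max metric, so the Euclidean plane is
   a separate copy of [R * R]; its topology is the one induced by its metric. *)
Definition eplane (R : realType) : Type := (R * R)%type.

HB.instance Definition _ (R : realType) := Choice.copy (eplane R) (R * R)%type.

Definition edist (R : realType) (p q : eplane R) : R :=
  Num.sqrt ((p.1 - q.1) ^+ 2 + (p.2 - q.2) ^+ 2).

Lemma edistxx (R : realType) (p : eplane R) : edist p p = 0.
Proof. by rewrite /edist !subrr expr0n addr0 sqrtr0. Qed.

Lemma edist_positivity (R : realType) (p q : eplane R) :
  edist p q = 0 -> p = q.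
Proof.
case: p q => [x y] [x' y']; rewrite /edist /= => /eqP.
rewrite sqrtr_eq0 => h.
have h1 := sqr_ge0 (x - x'); have h2 := sqr_ge0 (y - y').
have /eqP : (x - x') ^+ 2 = 0 by lra.
have /eqP : (y - y') ^+ 2 = 0 by lra.
by rewrite !sqrf_eq0 !subr_eq0 => /eqP -> /eqP ->.
Qed.

Lemma edist_sym (R : realType) (p q : eplane R) : edist p q = edist q p.
Proof. by rewrite /edist -(opprB p.1) -(opprB p.2) !sqrrN. Qed.

Lemma edist_triangle (R : realType) (q p r : eplane R) :
  edist p r <= edist p q + edist q r.
Proof.
rewrite /edist.
have -> : p.1 - r.1 = (p.1 - q.1) + (q.1 - r.1) by ring.
have -> : p.2 - r.2 = (p.2 - q.2) + (q.2 - r.2) by ring.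
move: (p.1 - q.1) (p.2 - q.2) (q.1 - r.1) (q.2 - r.2) => a b c d.
have sqD_ge0 (x y : R) : 0 <= x ^+ 2 + y ^+ 2 by rewrite addr_ge0 ?sqr_ge0.
rewrite -[leRHS]ger0_norm ?addr_ge0 ?sqrtr_ge0// -sqrtr_sqr ler_wsqrtr//.
rewrite [leRHS]sqrrD !sqr_sqrtr//.
have h : a * c + b * d <=
    Num.sqrt (a ^+ 2 + b ^+ 2) * Num.sqrt (c ^+ 2 + d ^+ 2).
  rewrite -sqrtrM// (le_trans (ler_norm _))// -sqrtr_sqr ler_wsqrtr//.
  have := sqr_ge0 (a * d - b * c); nra.
rewrite -mulr_natr; nra.
Qed.

HB.instance Definition _ (R : realType) :=
  @isMetric.Build R (eplane R) (@edist R)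
    (@edistxx R) (@edist_positivity R) (@edist_sym R) (@edist_triangle R).

Section subset_metric.
Context {R : realType} {X : metricType R} (A : set X).

Let dist (x y : set_type A) : R := mdist (set_val x) (set_val y).

Let dist_ge0 x y : 0 <= dist x y.
Proof. exact: mdist_ge0. Qed.

Let dist_positivity x y : dist x y = 0 -> x = y.
Proof. by move=> /mdist_positivity; exact: val_inj. Qed.

Let ballEdist x e : ball x e = [set y | dist x y < e].
Proof.
by rewrite /ball /= /initial_ball -[X in X = _]/(set_val @^-1` ball (set_val x) e)
  ballEmdist.
Qed.

HB.instance Definition _ :=
  @PseudoMetric_isMetric.Build R (set_type A) dist
    dist_ge0 dist_positivity ballEdist.

End subset_metric.

Definition homeomorphism_on (T U : topologicalType) (A : set T) (B : set U)
    (f : T -> U) : Prop :=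
  exists g : U -> T,
    [/\ set_fun A B f, set_fun B A g,
        {in A, cancel f g} & {in B, cancel g f}] /\
    ({within A, continuous f} /\ {within B, continuous g}).

Definition quasisymmetric (R : realType) (X Y : metricType R) (f : X -> Y) :
    Prop :=
  injective f /\
  exists eta : R -> R,
    @homeomorphism_on R R `[0, +oo[ `[0, +oo[ eta /\
    forall (x y z : X) (t : R), 0 < t ->
      mdist x y <= t * mdist x z ->
      mdist (f x) (f y) <= eta t * mdist (f x) (f z).

Definition qs_equivalent (R : realType) (X Y : metricType R) : Prop :=
  exists f : X -> Y, quasisymmetric f /\ set_surj [set: X] [set: Y] f.

Definition ternary_step (R : realType) (A : set R) : set R :=
  [set x / 3 | x in A] `|` [set x / 3 + 2 / 3 | x in A].

(* The metric |x - y| is attached to [R^o] in the library. *)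
Definition cantor_ternary (R : realType) : set R^o :=
  \bigcap_(k in [set: nat]) iter k (@ternary_step R) [set` `[0, 1]].

(* Rows and columns are numbered from 0: row [i : 'I_m] is row i + 1 on paper,
   and [a i j], [c i j] exist only for [j < n i], i.e. for (i, j) in D. *)
Record LGdata (R : realType) := {
  lg_m : nat;
  lg_n : 'I_lg_m -> nat;
  lg_b : 'I_lg_m -> R;
  lg_a : forall i : 'I_lg_m, 'I_(lg_n i) -> R;
  lg_c : forall i : 'I_lg_m, 'I_(lg_n i) -> R;
  lg_m_ge2 : (2 <= lg_m)%N;
  lg_b_gt0 : forall i, 0 < lg_b i;
  lg_b_sum1 : \sum_i lg_b i = 1;
  lg_D_nonempty : exists i, (0 < lg_n i)%N;
  lg_c_ge0 : forall i (j : 'I_(lg_n i)), 0 <= lg_c j;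
  lg_ab : forall i (j : 'I_(lg_n i)), [/\ 0 < lg_a j, lg_a j < lg_b i & lg_b i < 1];
  lg_a_sum : forall i, \sum_(j < lg_n i) lg_a j <= 1;
  lg_c_step : forall i (j k : 'I_(lg_n i)), k = j.+1 :> nat ->
    lg_a j <= lg_c k - lg_c j;
  lg_c_last : forall i (j : 'I_(lg_n i)), j.+1 = lg_n i ->
    lg_a j <= 1 - lg_c j
}.

Section LalleyGatzouras.
Context {R : realType} (L : LGdata R).

Definition lg_D : finType := {i : 'I_(lg_m L) & 'I_(lg_n i)}.

Definition lg_d (i : 'I_(lg_m L)) : R :=
  \sum_(k < lg_m L | (k < i)%N) lg_b k.

Definition lg_S (ij : lg_D) (p : eplane R) : eplane R :=
  (lg_a (tagged ij) * p.1 + lg_c (tagged ij),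
   lg_b (tag ij) * p.2 + lg_d (tag ij)).

Definition lalley_gatzouras_set (E : set (eplane R)) : Prop :=
  [/\ E !=set0, compact E & E = \bigcup_(ij in [set: lg_D]) (lg_S ij @` E)].

End LalleyGatzouras.

(* Main.v *)
(* The bridge is uniform disconnectedness: for some k > 0, distinct points x, y
   are never joined by a chain with steps at most k |x - y|. It is invariant
   under quasisymmetric maps and holds for the Cantor set; it implies total
   disconnectedness. If no row is empty, E projects densely onto [0, 1] in the
   y direction, and since a_ij < b_i the cylinders S_ij^n(E) are arbitrarily
   thin compared with their height, so E is not uniformly disconnected.

   Conversely, if E is totally disconnected then no row covers [0, 1) (otherwise
   E contains a horizontal segment), so every row has a hole, and an empty row
   is a hole of the projection to the y axis. Zooming in, every interval of
   length s contains a hole of length comparable to s, both for the projection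
   and for the horizontal sections of a strip of height small compared to s. A
   thin horizontal band meets at most two such strips, so each point of E at
   each scale s sits in a box of size about s whose sides are holes of E of
   width comparable to s: E is uniformly disconnected. It is also uniformly
   perfect, and a set in the plane is doubling, so the classes of the relations
   "joined by a chain with steps at most 2 lambda^k" form a tree with between 2
   and N children at each vertex. Spreading it over the binary tree matches E
   with the ternary digits of the Cantor set, quasisymmetrically (this is the
   David-Semmes characterization of the Cantor set). *)
Require Import Defs.
From mathcomp Require Import all_boot all_order all_algebra.
From mathcomp Require Import ring lra zify.
From mathcomp Require Import boolp classical_sets functions reals topology.
From mathcomp Require Import normedtype sequences derive realfun.

Set Implicit Arguments.
Unset Strict Implicit.
Unset Printing Implicit Defensive.

Import Order.TTheory GRing.Theory Num.Theory.
Import numFieldNormedType.Exports.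

Local Open Scope classical_set_scope.
Local Open Scope ring_scope.

(** * Chains and uniform disconnectedness *)

Lemma exprn_small (R : realType) (x e : R) : 0 <= x -> x < 1 -> 0 < e ->
  exists n, x ^+ n < e.
Proof.
move=> x0 x1 e0.
have : (fun n => x ^+ n) @ \oo --> 0 by apply: cvg_expr; rewrite ger0_norm.
move=> /cvgrPdist_lt/(_ e e0)[n _ /(_ n (leqnn n))] /=.
by rewrite sub0r normrN ger0_norm ?exprn_ge0//; exists n.
Qed.

Lemma first_difference (b b' : nat -> bool) : ~ (b =1 b') ->
  exists n, (forall m, (m < n)%N -> b m = b' m) /\ b n <> b' n.
Proof.
move=> ne; have ex : exists n, b n != b' n.
  apply: contrapT => h; apply: ne => n; apply/eqP/negP => /negP h'.
  by apply: h; exists n.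
exists (ex_minn ex); case: ex_minnP => n /eqP nn mn; split=> // m mn'.
by apply/eqP; apply: contraTT mn' => /mn; rewrite -leqNgt.
Qed.

Section Chains.
Context {R : realType} {X : metricType R}.
Implicit Types (A : set X) (x y z : X) (r : R).

(* [y] lies in every set containing [x] that is stable under steps of length at
   most [r] inside [A]. *)
Definition chain A r x y : Prop :=
  forall P : set X, P x ->
    (forall u v, A u -> A v -> P u -> mdist u v <= r -> P v) -> P y.

Definition unif_disconnected A : Prop :=
  exists2 k : R, 0 < k &
    forall x y, A x -> A y -> x <> y -> ~ chain A (k * mdist x y) x y.

Lemma chain_refl A r x : chain A r x x.
Proof. by move=> P Px _. Qed.

Lemma chain_step A r x y : A x -> A y -> mdist x y <= r -> chain A r x y.
Proof. by move=> Ax Ay xy P Px hP; apply: (hP x y). Qed.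

Lemma chain_trans A r y x z : chain A r x y -> chain A r y z -> chain A r x z.
Proof. by move=> xy yz P Px hP; apply: yz => //; exact: xy. Qed.

Lemma chain_sym A r x y : chain A r x y -> chain A r y x.
Proof.
move=> xy; apply: (xy (chain A r ^~ x)); first exact: chain_refl.
move=> u v Au Av ux uv; apply: chain_trans ux.
by apply: chain_step => //; rewrite metric_sym.
Qed.

Lemma chain_le A r r' x y : r <= r' -> chain A r x y -> chain A r' x y.
Proof.
move=> rr' xy P Px hP; apply: xy => // u v Au Av Pu uv.
by apply: hP Pu _ => //; exact: le_trans uv rr'.
Qed.

(** Metric form of uniform disconnectedness: with [C] the inverse of [k], points further apart than
    [C * r] are joined by no chain of step [r]. *)
Lemma chain_diam A : unif_disconnected A -> exists2 C : R, 0 < C &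
  forall r x y, 0 <= r -> A x -> A y -> chain A r x y -> mdist x y <= C * r.
Proof.
move=> [k k0 hk]; exists k^-1; first by rewrite invr_gt0.
move=> r x y r0 Ax Ay xy; rewrite leNgt; apply/negP => lt.
have [e|/eqP ne] := eqVneq x y.
  by move: lt; rewrite e mdistxx ltNge mulr_ge0// invr_ge0 ltW.
apply: (hk x y Ax Ay ne); apply: chain_le xy.
by rewrite -(@ler_pM2l _ k^-1) ?invr_gt0// mulKf ?gt_eqF// ltW.
Qed.

(** The points of a connected [B] reachable from [x] by steps at most [r] form a set open and closed
    in [B], while [r = k * mdist x y] keeps [y] out of it. *)
Lemma unif_disconnected_totally A :
  unif_disconnected A -> totally_disconnected A.
Proof.
move=> [k k0 hk] x Ax; apply/seteqP; split; last first.
  by move=> _ ->; exact: connected_component_refl.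
move=> y [B [Bx BA cB] By] /=; apply: contrapT => nyx.
have nxy : x <> y by move/esym.
have Ay := BA _ By.
have D0 : 0 < k * mdist x y by rewrite mulr_gt0// mdist_gt0; apply/eqP.
apply: (hk x y Ax Ay nxy); set r := k * mdist x y in D0 *.
pose U (S : set X) := \bigcup_(z in B `&` S) (ball z r)^°.
have oU S : open (U S) by apply: bigcup_open => z _; exact: open_interior.
have inU (S : set X) z : B z -> S z -> U S z.
  by move=> Bz Sz; exists z => //; exact: nbhsx_ballx.
have outU (S : set X) z : U S z -> exists w, [/\ B w, S w & mdist w z < r].
  by move=> [w [Bw Sw]] /interior_subset; rewrite ballEmdist/=; exists w.
pose S := chain A r x.
have e : B `&` S = B.
  apply: cB; first by exists x; split => //; exact: chain_refl.
    exists (U S) => //; apply/seteqP; split => z /= [Bz].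
      by move=> Sz; split => //; exact: inU.
    move=> /outU[w [Bw Sw /ltW wz]]; split => //.
    by apply: chain_trans Sw _; apply: chain_step => //; exact: BA.
  exists (~` U (~` S)); first by rewrite closedC; exact: oU.
  apply/seteqP; split => z /= [Bz].
    move=> Sz; split => // /outU[w [Bw Sw /ltW wz]]; apply: Sw.
    apply: chain_trans Sz _; apply: chain_step; [exact: BA|exact: BA|].
    by rewrite metric_sym.
  by move=> nU; split => //; apply: contrapT => nS; exact/nU/inU.
by rewrite -e in By; case: By.
Qed.

End Chains.

(** * Binary codings and the Cantor set *)

(** Points realizing longer and longer prefixes of [b] cluster in the compact set, and local
    constancy of each prefix carries the digits over to the cluster point. *)
Lemma code_surj (R : realType) (X : metricType R) (A : set X)
    (beta : X -> nat -> bool) :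
  compact A ->
  (forall x n, A x -> exists2 e : R, 0 < e & forall y, A y -> mdist x y < e ->
     forall m, (m < n)%N -> beta x m = beta y m) ->
  (forall b n, exists2 x, A x & forall m, (m < n)%N -> beta x m = b m) ->
  forall b : nat -> bool, exists2 x, A x & forall m, beta x m = b m.
Proof.
move=> cA loc real b.
have /choice[s hs] : forall n, exists x,
    A x /\ forall m, (m < n)%N -> beta x m = b m.
  by move=> n; have [x] := real b n; exists x.
have [x [Ax clx]] : A `&` cluster (s @ \oo) !=set0.
  by apply: cA; exists 0%N => // n _; have [] := hs n.
exists x => // m; have [e e0 he] := loc x m.+1 Ax.
have tail : (s @ \oo) [set s n | n in [set n | m < n]%N].
  by exists m.+1 => // n mn; exists n.
have [_ [[n mn <-]]] := clx _ _ tail (nbhsx_ballx x e e0).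
rewrite ballEmdist/= => xn; have [An hn] := hs n.
by rewrite (he _ An xn m (ltnSn m)) hn.
Qed.

(** * Ternary digits on the Cantor set *)

Section Cantor.
Context {R : realType}.
Implicit Types u v : R^o.
Local Notation C := (@cantor_ternary R).

(** On the Cantor set this inverts [x / 3] and [x / 3 + 2 / 3], dropping the first ternary digit;
    [true] stands for the ternary digit 2 in [tdigit]. *)
Definition triple_shift u : R^o := if u < 1 / 2 then 3 * u else 3 * u - 2.

Definition tdigit u n : bool := 1 / 2 <= iter n triple_shift u.

Lemma tdigitS u n : tdigit u n.+1 = tdigit (triple_shift u) n.
Proof. by rewrite /tdigit iterSr. Qed.

Lemma iter_ternary01 k u : iter k (@ternary_step R) [set` `[0, 1]] u ->
  0 <= u <= 1.
Proof.
elim: k u => [u /=|k IH u]; first by rewrite in_itv.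
by rewrite iterS => -[] [x /IH /andP[x0 x1] <-]; apply/andP; split; lra.
Qed.

Lemma cantor01 u : C u -> 0 <= u <= 1.
Proof. by move=> /(_ 0%N I) /iter_ternary01. Qed.

Lemma cantor_shift u : C u -> C (triple_shift u).
Proof.
move=> Cu k _; have := Cu k.+1 I.
rewrite iterS /triple_shift => -[] [x kx <-];
  have /andP[x0 x1] := iter_ternary01 kx; case: ltP => h; try lra.
  by have -> : 3 * (x / 3) = x by field.
by have -> : 3 * (x / 3 + 2 / 3) - 2 = x by field.
Qed.

Lemma cantor_gap u : C u -> u <= 1 / 3 \/ 2 / 3 <= u.
Proof.
move=> /(_ 1%N I) [] [x /= hx <-]; have /andP[x0 x1] : 0 <= x <= 1 by [].
- by left; lra.
- by right; lra.
Qed.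

Lemma cantor_cons (d : bool) u : C u -> C (u / 3 + d%:R * (2 / 3)).
Proof.
move=> Cu [|k] _.
  have /andP[u0 u1] := cantor01 Cu.
  by rewrite /= in_itv/=; case: d; rewrite ?mulr1n ?mulr0n; apply/andP; split; lra.
rewrite iterS; case: d; [right|left]; exists u; try exact: Cu.
  by rewrite mul1r.
by rewrite mul0r addr0.
Qed.

Lemma shift_cons (d : bool) u : C u ->
  tdigit (u / 3 + d%:R * (2 / 3)) 0 = d /\
  triple_shift (u / 3 + d%:R * (2 / 3)) = u.
Proof.
move=> /cantor01/andP[u0 u1]; rewrite /tdigit /triple_shift /=.
by case: d; rewrite ?mulr1n ?mulr0n; case: ltP => h; split; lra.
Qed.

(** The shift triples the distance between points with the same first digit, which drives the
    induction. *)
Lemma cantor_dist_ub n u v : C u -> C v ->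
  (forall m, (m < n)%N -> tdigit u m = tdigit v m) -> mdist u v <= 3^-1 ^+ n.
Proof.
elim: n u v => [|n IH] u v Cu Cv h.
  have := cantor01 Cu; have := cantor01 Cv => /andP[v0 v1] /andP[u0 u1].
  by rewrite expr0 ler_norml; apply/andP; split; lra.
have := h 0%N isT; rewrite /tdigit/= => h0.
have := IH _ _ (cantor_shift Cu) (cantor_shift Cv).
rewrite exprS -[mdist u v]/`|v - u| -[mdist _ _]/`| _ - _|.
move=> /(_ _)/wrap[].
  by move=> m mn; rewrite -!tdigitS; exact: h.
rewrite /triple_shift; move: h0; case: ltP => hu; case: ltP => hv // _.
  by rewrite -mulrBr normrM ger0_norm//; lra.
have -> : 3 * v - 2 - (3 * u - 2) = 3 * (v - u) by ring.
by rewrite normrM ger0_norm//; lra.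
Qed.

(** Same induction; points with different first digits lie on the two sides of the middle gap, of
    length 1/3. *)
Lemma cantor_dist_lb n u v : C u -> C v ->
  (forall m, (m < n)%N -> tdigit u m = tdigit v m) ->
  tdigit u n <> tdigit v n -> 3^-1 ^+ n.+1 <= mdist u v.
Proof.
elim: n u v => [|n IH] u v Cu Cv h hn.
  move: hn; rewrite /tdigit/= expr1 -[mdist u v]/`|v - u|.
  have [] := cantor_gap Cu; have [] := cantor_gap Cv => hv hu.
  - by do 2 (case: leP => ?; try lra).
  - by move=> _; rewrite ler_normr; apply/orP; left; lra.
  - by move=> _; rewrite ler_normr; apply/orP; right; lra.
  - by do 2 (case: leP => ?; try lra).
have := h 0%N isT; rewrite /tdigit/= => h0.
rewrite !tdigitS in hn.
have := IH _ _ (cantor_shift Cu) (cantor_shift Cv) _ hn.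
rewrite [3^-1 ^+ n.+2]exprS -[mdist u v]/`|v - u| -[mdist _ _]/`| _ - _|.
move=> /(_ _)/wrap[].
  by move=> m mn; rewrite -!tdigitS; exact: h.
rewrite /triple_shift; move: h0; case: ltP => hu; case: ltP => hv // _.
  by rewrite -mulrBr normrM ger0_norm//; lra.
have -> : 3 * v - 2 - (3 * u - 2) = 3 * (v - u) by ring.
by rewrite normrM ger0_norm//; lra.
Qed.

Lemma tdigit_inj u v : C u -> C v -> tdigit u =1 tdigit v -> u = v.
Proof.
move=> Cu Cv uv; apply: mdist_positivity; apply/eqP; rewrite eq_le mdist_ge0.
rewrite andbT; apply/ler_addgt0Pl => e e0; rewrite addr0.
have [//||n] := @exprn_small R 3^-1 e _ _ e0; try lra.
by move=> /ltW; apply: le_trans; apply: cantor_dist_ub => // m _.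
Qed.

Lemma tdigit_pattern (b : nat -> bool) n :
  exists2 u, C u & forall m, (m < n)%N -> tdigit u m = b m.
Proof.
elim: n b => [|n IH] b.
  exists 0 => // k _; elim: k => [|k IH]; first by rewrite /= in_itv/= lexx ler01.
  by rewrite iterS; left; exists 0 => //; rewrite mul0r.
have [u Cu hu] := IH (b \o succn).
have [h0 hs] := shift_cons (b 0%N) Cu.
exists (u / 3 + (b 0%N)%:R * (2 / 3)); first exact: cantor_cons.
by move=> [//|m] mn; rewrite tdigitS hs hu.
Qed.

Lemma cantor_compact : compact C.
Proof.
apply: (@subclosed_compact _ _ [set` `[0 : R, 1]]); last first.
- by move=> u /cantor01; rewrite /= in_itv.
- exact: segment_compact.
apply: closed_bigI => k _; elim: k => [|k IH]; first exact: interval_closed.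
rewrite iterS; apply: closedU.
  (* Turning the image into a preimage under a continuous map makes closedness immediate. *)
  have -> : [set x / 3 | x in iter k (@ternary_step R) [set` `[0, 1]]] =
      (fun x : R^o => 3 * x : R^o) @^-1` iter k (@ternary_step R) [set` `[0, 1]].
    apply/seteqP; split => [_ [x kx <-]|x kx] /=.
      by have -> : 3 * (x / 3) = x by field.
    by exists (3 * x) => //; field.
  apply: closed_comp IH => x _; exact: mulrl_continuous.
have -> : [set x / 3 + 2 / 3 | x in iter k (@ternary_step R) [set` `[0, 1]]] =
    (fun x : R^o => 3 * x - 2 : R^o) @^-1`
      iter k (@ternary_step R) [set` `[0, 1]].
  apply/seteqP; split => [_ [x kx <-]|x kx] /=.
    by have -> : 3 * (x / 3 + 2 / 3) - 2 = x by field.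
  by exists (3 * x - 2) => //; field.
apply: closed_comp IH => x _.
by apply: cvgB; [exact: mulrl_continuous|exact: cvg_cst].
Qed.

Lemma cantor_close n u v : C u -> C v -> mdist u v < 3^-1 ^+ n ->
  forall m, (m < n)%N -> tdigit u m = tdigit v m.
Proof.
move=> Cu Cv uv m; elim/ltn_ind: m => m IH mn; apply: contrapT => ne.
have am i : (i < m)%N -> tdigit u i = tdigit v i.
  by move=> im; apply: IH => //; exact: ltn_trans mn.
have := cantor_dist_lb Cu Cv am ne; rewrite leNgt => /negP; apply.
by apply: lt_le_trans uv _; apply: ler_wiXn2l => //; lra.
Qed.

Lemma tdigit_surj (b : nat -> bool) : exists2 u, C u & tdigit u =1 b.
Proof.
apply: (code_surj cantor_compact _ tdigit_pattern) => u n Cu.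
exists (3^-1 ^+ n); first by rewrite exprn_gt0// invr_gt0.
by move=> v Cv; exact: cantor_close.
Qed.

End Cantor.

(** * Quasisymmetric coding by ternary digits *)

Section RootPower.
Context {R : realType}.
Implicit Types (x y : R) (p : nat).

(** The root of order [2 ^ p]; exponents that are powers of two need square roots only. *)
Definition iter_sqrt p x : R := iter p Num.sqrt x.

Lemma iter_sqrt_ge0 p x : 0 <= x -> 0 <= iter_sqrt p x.
Proof. by case: p => // p _; exact: sqrtr_ge0. Qed.

Lemma iter_sqrtK p x : 0 <= x -> iter_sqrt p x ^+ (2 ^ p) = x.
Proof.
move=> x0; elim: p => [|p IH]; first by rewrite expn0 expr1.
by rewrite expnS exprM sqr_sqrtr ?iter_sqrt_ge0.
Qed.

Lemma exprK_iter_sqrt p x : 0 <= x -> iter_sqrt p (x ^+ (2 ^ p)) = x.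
Proof.
move=> x0; elim: p => [|p IH]; first by rewrite expn0 expr1.
by rewrite /iter_sqrt iterSr expnSr exprM sqrtr_sqr ger0_norm// exprn_ge0.
Qed.

Lemma iter_sqrt_le p x y : x <= y -> iter_sqrt p x <= iter_sqrt p y.
Proof. by move=> xy; elim: p => //= p IH; exact: ler_wsqrtr. Qed.

Lemma iter_sqrt1 p : iter_sqrt p 1 = 1 :> R.
Proof. by elim: p => //= p ->; rewrite sqrtr1. Qed.

Lemma iter_sqrt_continuous p : continuous (iter_sqrt p).
Proof.
elim: p => [|p IH] x; first exact: cvg_id.
exact: (@continuous_comp _ _ _ (iter_sqrt p) (@Num.sqrt R) x (IH x)
  (@sqrt_continuous R _)).
Qed.

(* Dominates both [x ^ (1/P)] and [x ^ P], with [P = 2 ^ p]. *)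
Definition root_power p x : R := Num.max (iter_sqrt p x) (x ^+ (2 ^ p)).

(** The inverse of [root_power p] on nonnegative reals: the power below 1, the root above 1. *)
Definition power_root p x : R := Num.min (x ^+ (2 ^ p)) (iter_sqrt p x).

Lemma root_power_ge0 p x : 0 <= x -> 0 <= root_power p x.
Proof. by move=> x0; rewrite le_max iter_sqrt_ge0. Qed.

Lemma power_root_ge0 p x : 0 <= x -> 0 <= power_root p x.
Proof. by move=> x0; rewrite le_min iter_sqrt_ge0// exprn_ge0. Qed.

Lemma iter_sqrt_bounds p x : 0 <= x ->
  (x <= 1 -> x ^+ (2 ^ p) <= x <= iter_sqrt p x /\ iter_sqrt p x <= 1) /\
  (1 <= x -> iter_sqrt p x <= x <= x ^+ (2 ^ p) /\ 1 <= iter_sqrt p x).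
Proof.
move=> x0; have P0 : (0 < 2 ^ p)%N by rewrite expn_gt0.
have h (y : R) : 0 <= y ->
    (y <= 1 -> y ^+ (2 ^ p) <= y) /\ (1 <= y -> y <= y ^+ (2 ^ p)).
  move=> y0; split=> y1; first by rewrite ler_iXnr.
  by rewrite ler_eXnr.
have [h1 h2] := h _ x0; have [h3 h4] := h _ (iter_sqrt_ge0 p x0).
rewrite iter_sqrtK// in h3 h4; split => x1.
  have r1 : iter_sqrt p x <= 1 by rewrite -(iter_sqrt1 p) iter_sqrt_le.
  by rewrite h1// h3.
have r1 : 1 <= iter_sqrt p x by rewrite -(iter_sqrt1 p) iter_sqrt_le.
by rewrite h2// h4.
Qed.

Lemma root_powerK p x : 0 <= x -> power_root p (root_power p x) = x.
Proof.
move=> x0; have [h1 h2] := iter_sqrt_bounds p x0; rewrite /root_power.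
have [x1|/ltW x1] := leP x 1.
  have [/andP[l1 l2] l3] := h1 x1.
  have -> : Num.max (iter_sqrt p x) (x ^+ (2 ^ p)) = iter_sqrt p x.
    by apply/max_idPl; exact: le_trans l2.
  have [/(_ l3)[/andP[_ l4] _] _] := iter_sqrt_bounds p (iter_sqrt_ge0 p x0).
  by rewrite /power_root iter_sqrtK//; apply/min_idPl; exact: le_trans l4.
have [/andP[l1 l2] l3] := h2 x1.
have -> : Num.max (iter_sqrt p x) (x ^+ (2 ^ p)) = x ^+ (2 ^ p).
  by apply/max_idPr; exact: le_trans l2.
have xp1 : 1 <= x ^+ (2 ^ p) by exact: le_trans l2.
have [_ /(_ xp1)[/andP[_ l4] _]] := iter_sqrt_bounds p (exprn_ge0 (2 ^ p) x0).
by rewrite /power_root exprK_iter_sqrt//; apply/min_idPr; exact: le_trans l4.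
Qed.

Lemma power_rootK p x : 0 <= x -> root_power p (power_root p x) = x.
Proof.
move=> x0; have [h1 h2] := iter_sqrt_bounds p x0; rewrite /power_root.
have [x1|/ltW x1] := leP x 1.
  have [/andP[l1 l2] l3] := h1 x1.
  have -> : Num.min (x ^+ (2 ^ p)) (iter_sqrt p x) = x ^+ (2 ^ p).
    by apply/min_idPl; exact: le_trans l2.
  have xp1 : x ^+ (2 ^ p) <= 1 by exact: le_trans x1.
  have [/(_ xp1)[/andP[l4 _] _] _] := iter_sqrt_bounds p (exprn_ge0 (2 ^ p) x0).
  by rewrite /root_power exprK_iter_sqrt//; apply/max_idPl; exact: le_trans l1.
have [/andP[l1 l2] l3] := h2 x1.
have -> : Num.min (x ^+ (2 ^ p)) (iter_sqrt p x) = iter_sqrt p x.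
  by apply/min_idPr; exact: le_trans l2.
have [_ /(_ l3)[/andP[l4 _] _]] := iter_sqrt_bounds p (iter_sqrt_ge0 p x0).
by rewrite /root_power iter_sqrtK//; apply/max_idPr; exact: le_trans l1.
Qed.

Lemma root_power_continuous p : continuous (root_power p).
Proof.
move=> x; apply: (@continuous_max R R (iter_sqrt p) (fun x => x ^+ (2 ^ p))).
  exact: iter_sqrt_continuous.
exact: exprn_continuous.
Qed.

Lemma power_root_continuous p : continuous (power_root p).
Proof.
move=> x; apply: (@continuous_min R R (fun x => x ^+ (2 ^ p)) (iter_sqrt p)).
  exact: exprn_continuous.
exact: iter_sqrt_continuous.
Qed.

Lemma root_power_homeo p (M K : R) : 0 < M -> 0 < K ->
  @homeomorphism_on R R `[0, +oo[ `[0, +oo[ (fun t => M * root_power p (K * t)).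
Proof.
move=> M0 K0; exists (fun u => K^-1 * power_root p (M^-1 * u)).
have [MN KN] : M != 0 /\ K != 0 by rewrite !gt_eqF.
have [Mi Ki] : 0 <= M^-1 /\ 0 <= K^-1 by rewrite !invr_ge0 !ltW.
split; split.
- move=> t /=; rewrite !in_itv/= !andbT => t0.
  by rewrite mulr_ge0 ?root_power_ge0 ?mulr_ge0// ltW.
- move=> t /=; rewrite !in_itv/= !andbT => t0.
  by rewrite mulr_ge0 ?power_root_ge0 ?mulr_ge0// ltW.
- move=> t; rewrite inE/= in_itv/= andbT => t0.
  by rewrite mulKf// root_powerK ?mulKf ?mulr_ge0// ltW.
- move=> t; rewrite inE/= in_itv/= andbT => t0.
  by rewrite mulVKf// power_rootK ?mulVKf ?mulr_ge0// ltW.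
- apply: continuous_subspaceT => t.
  apply: (@continuous_comp _ _ _ (fun t => root_power p (K * t)) (fun u => M * u)).
    apply: (@continuous_comp _ _ _ (fun t => K * t) (root_power p)).
      exact: mulrl_continuous.
    exact: root_power_continuous.
  exact: mulrl_continuous.
- apply: continuous_subspaceT => t.
  apply: (@continuous_comp _ _ _ (fun t => power_root p (M^-1 * t))
    (fun u => K^-1 * u)).
    apply: (@continuous_comp _ _ _ (fun t => M^-1 * t) (power_root p)).
      exact: mulrl_continuous.
    exact: power_root_continuous.
  exact: mulrl_continuous.
Qed.

End RootPower.

(** * Compact sets coded by binary words *)

Section CodedSpace.
Context {R : realType} {X : metricType R}.
(** [beta] codes the points, and [lam ^+ lev x n] is the scale reached after [n] digits of [x];
    [lev] gains at most one level per digit and at least one per [N] digits. *)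
Variables (A : set X) (beta : X -> nat -> bool) (lev : X -> nat -> nat).
Variables (p N : nat) (K : R).
Local Notation lam := (3^-1 ^+ (2 ^ p) : R).
Local Notation agree n x y := (forall m, (m < n)%N -> beta x m = beta y m).
Hypothesis K_gt0 : 0 < K.
Hypothesis lev_step : forall x n i, (lev x n <= lev x (n + i) <= lev x n + i)%N.
Hypothesis lev_grow : forall x n i, A x ->
  (lev x n + i <= lev x (n + N * i))%N.
Hypothesis agree_dist : forall n x y, A x -> A y -> agree n x y ->
  mdist x y <= K * lam ^+ lev x n.
Hypothesis differ_dist : forall n x y, A x -> A y -> agree n x y ->
  beta x n <> beta y n -> lam ^+ lev x n <= K * mdist x y.
Hypothesis patterns : forall b n, exists2 x, A x &
  forall m, (m < n)%N -> beta x m = b m.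
Hypothesis compactA : compact A.

Let lam_gt0 : 0 < lam. Proof. by rewrite !exprn_gt0 ?invr_gt0. Qed.

Let lam_lt1 : lam < 1.
Proof. by rewrite exprn_ilt1// -?lt0n ?expn_gt0//; lra. Qed.

Lemma beta_inj x y : A x -> A y -> beta x =1 beta y -> x = y.
Proof.
move=> Ax Ay xy; apply: mdist_positivity; apply/eqP; rewrite eq_le mdist_ge0.
rewrite andbT; apply/ler_addgt0Pl => e e0; rewrite addr0.
have [i] := exprn_small (ltW lam_gt0) lam_lt1 (divr_gt0 e0 K_gt0).
rewrite ltr_pdivlMr// mulrC => /ltW; apply: le_trans.
have /le_trans := agree_dist Ax Ay (fun m (_ : (m < 0 + N * i)%N) => xy m).
apply; rewrite ler_pM2l// ler_wiXn2l ?ltW//.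
exact: leq_trans (leq_addl _ _) (lev_grow 0 i Ax).
Qed.

Lemma beta_loc x n : A x -> exists2 e : R, 0 < e &
  forall y, A y -> mdist x y < e -> agree n x y.
Proof.
move=> Ax; exists (K^-1 * lam ^+ lev x n).
  by rewrite mulr_gt0 ?invr_gt0// exprn_gt0.
move=> y Ay xy m; elim/ltn_ind: m => m IH mn; apply: contrapT => ne.
have am : agree m x y by move=> i im; apply: IH => //; exact: ltn_trans mn.
have := differ_dist Ax Ay am ne; apply/negP; rewrite -ltNge.
rewrite -(ltr_pM2l K_gt0) mulVKf ?gt_eqF// in xy.
apply: lt_le_trans xy _; rewrite ler_wiXn2l ?ltW//.
by have /andP[] := lev_step x m (n - m); rewrite subnKC// ltnW.
Qed.

(** [2 ^ q] dominates both [2 ^ p] and [N], the exponents met in the two cases below. *)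
Let q := (p + N)%N.

(** If [m <= n], levels rise by at most one per digit, so [lam ^+ (n - m) <= s] and
    [3^-1 ^+ (n - m)] is at most a root of [s]. If [n < m], levels rise by one every [N] digits, so
    [3 ^+ i <= s] with [i] about [(m - n) / N], and [3 ^+ (m - n)] is at most [3 ^+ N] times a power
    of [s]. *)
Let ratio_bound (s : R) x n m : A x -> lam ^+ lev x n <= s * lam ^+ lev x m ->
  3^-1 ^+ n <= 3 ^+ N.+1 * root_power q s * 3^-1 ^+ m.+1.
Proof.
move=> Ax h.
have lamX k : 0 < lam ^+ k by rewrite exprn_gt0.
have s0 : 0 <= s.
  by rewrite -(pmulr_lge0 _ (lamX (lev x m))); apply: le_trans h; exact: ltW.
have N3 : 1 <= 3 ^+ N :> R by rewrite exprn_ege1//; lra.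
have t0 k : 0 < 3^-1 ^+ k :> R by rewrite exprn_gt0// invr_gt0.
have [mn|nm] := leqP m n.
  have lb : (lev x n <= lev x m + (n - m))%N.
    by have /andP[] := lev_step x m (n - m); rewrite subnKC.
  have hs : (3^-1 ^+ (n - m)) ^+ (2 ^ p) <= s :> R.
    rewrite -(ler_pM2r (lamX (lev x m))).
    apply: le_trans h; rewrite -exprM mulnC exprM -exprD addnC.
    by rewrite ler_wiXn2l ?ltW.
  have hr : 3^-1 ^+ (n - m) <= iter_sqrt q s.
    rewrite -[leLHS](exprK_iter_sqrt q (ltW (t0 _))); apply: iter_sqrt_le.
    apply: le_trans hs; apply: ler_wiXn2l; first exact: ltW.
      by rewrite exprn_ile1//; lra.
    by rewrite leq_exp2l// leq_addr.
  have hR : 3^-1 ^+ (n - m) <= root_power q s by rewrite le_max hr.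
  rewrite -{1}(subnK mn) exprD exprS exprS.
  have := t0 m; have := t0 (n - m)%N.
  have -> : 3 * 3 ^+ N * root_power q s * (3^-1 * 3^-1 ^+ m) =
    3 ^+ N * root_power q s * 3^-1 ^+ m :> R by field.
  move=> h1 h2; rewrite ler_pM2r//; apply: (le_trans hR).
  by rewrite ler_peMl//; apply: le_trans hR; exact: ltW.
(* With [N = 0] the level would have to grow without any further digit. *)
have [N0|N0] := posnP N.
  have := lev_grow 0 (lev x 0).+1 Ax.
  by rewrite N0 mul0n addn0 addnS ltnNge leq_addr.
pose i := ((m - n) %/ N)%N.
have hi : (m - n <= N * i + N)%N.
  have := divn_eq (m - n) N; rewrite -/i; have := ltn_pmod (m - n) N0; lia.
have lb : (lev x n + i <= lev x m)%N.
  apply: leq_trans (lev_grow n i Ax) _.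
  have := lev_step x (n + N * i) (m - (n + N * i)).
  rewrite subnKC; first by case/andP.
  by have := leq_trunc_div (m - n) N; rewrite -/i; lia.
have h1 : 1 <= s * lam ^+ i.
  rewrite -(ler_pM2r (lamX (lev x n))) mul1r -mulrA -exprD.
  apply: (le_trans h); rewrite ler_wpM2l// ler_wiXn2l ?ltW//.
  by rewrite addnC.
have h3 : 3 ^+ i <= s.
  have : (3 ^+ i) ^+ (2 ^ p) <= s.
    rewrite -exprM mulnC exprM.
    rewrite -(ler_pM2r (lamX i)) -exprMn -exprMn mulfV ?pnatr_eq0//.
    by rewrite !expr1n.
  apply: le_trans; rewrite ler_eXnr ?expn_gt0// exprn_ege1//; lra.
have s1 : 1 <= s by apply: le_trans h3; rewrite exprn_ege1//; lra.
have h4 : 3 ^+ (N * i) <= s ^+ (2 ^ q).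
  rewrite mulnC exprM.
  apply: (@le_trans _ _ (s ^+ N)).
    by rewrite lerXn2r// nnegrE// exprn_ge0.
  rewrite ler_weXn2l//; apply: (@leq_trans (2 ^ N)).
    exact: ltnW (ltn_expl _ _).
  by rewrite leq_exp2l// leq_addl.
have h5 : 3 ^+ (N * i) <= root_power q s by rewrite le_max h4 orbT.
have h6 : 3 ^+ (m - n) <= 3 ^+ N * root_power q s.
  apply: (@le_trans _ _ (3 ^+ (N + N * i))).
    by rewrite ler_weXn2l//; [lra|rewrite addnC].
  by rewrite exprD ler_pM2l//; lra.
have -> : 3^-1 ^+ n = 3 ^+ (m - n) * 3^-1 ^+ m :> R.
  rewrite -{2}(subnK (ltnW nm)) exprD mulrA -exprMn mulfV ?pnatr_eq0//.
  by rewrite expr1n mul1r.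
rewrite exprS exprS.
have -> : 3 * 3 ^+ N * root_power q s * (3^-1 * 3^-1 ^+ m) =
    3 ^+ N * root_power q s * 3^-1 ^+ m :> R by field.
by rewrite ler_pM2r.
Qed.

(** Each point goes to the Cantor point whose ternary digits are its code. The first differences [n]
    of [x], [y] and [m] of [x], [z] determine all distances up to constants. *)
Theorem coded_qs_cantor :
  qs_equivalent (set_type A) (set_type (@cantor_ternary R)).
Proof.
have /choice[f hf] : forall x : set_type A,
    exists u : set_type (@cantor_ternary R),
      tdigit (set_val u) =1 beta (set_val x).
  move=> x.
  have [u Cu hu] := @tdigit_surj R (beta (set_val x)).
  by exists (exist _ u (mem_set Cu)).
have valA (x : set_type A) : A (set_val x) by exact: set_valP.
have valC (u : set_type (@cantor_ternary R)) : cantor_ternary (set_val u).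
  exact: set_valP.
exists f; split; last first.
  move=> u _.
  have [x Ax hx] := code_surj compactA (@beta_loc) patterns (tdigit (set_val u)).
  exists (exist _ x (mem_set Ax)) => //; apply: val_inj.
  apply: tdigit_inj; [exact: valC|exact: valC|].
  by move=> n; exact: etrans (hf (exist _ x (mem_set Ax)) n) (hx n).
split.
  move=> x y fxy; apply: val_inj; apply: beta_inj (valA _) (valA _) _ => n.
  have := hf y n; rewrite -fxy => h; exact: etrans (esym (hf x n)) h.
exists (fun t => 3 ^+ N.+1 * root_power q (K ^+ 2 * t)); split.
  by apply: root_power_homeo; rewrite exprn_gt0.
move=> x y z t t0 xyz.
have [xy|nxy] := pselect (beta (set_val x) =1 beta (set_val y)).
  have -> : y = x.
    by apply: val_inj; apply: beta_inj (valA _) (valA _) _ => n; rewrite xy.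
  rewrite mdistxx mulr_ge0 ?mdist_ge0// mulr_ge0 ?exprn_ge0//.
  by rewrite root_power_ge0// mulr_ge0 ?exprn_ge0 ?ltW.
have [xz|nxz] := pselect (beta (set_val x) =1 beta (set_val z)).
  have xz' : z = x.
    by apply: val_inj; apply: beta_inj (valA _) (valA _) _ => n; rewrite xz.
  rewrite xz' mdistxx mulr0 in xyz.
  have yx : x = y by apply: mdist_positivity; apply/eqP; rewrite eq_le xyz mdist_ge0.
  by case: nxy; rewrite yx.
have [n [an dn]] := first_difference nxy.
have [m [am dm]] := first_difference nxz.
(* One factor [K] comes from the lower bound on the distance of [x] and [y], the other from the
   upper bound on that of [x] and [z]. *)
have rb : lam ^+ lev (set_val x) n <= K ^+ 2 * t * lam ^+ lev (set_val x) m.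
  apply: le_trans (differ_dist (valA x) (valA y) an dn) _.
  apply: (@le_trans _ _ (K * (t * mdist (set_val x) (set_val z)))).
    by rewrite ler_pM2l.
  have -> : K ^+ 2 * t * lam ^+ lev (set_val x) m =
    K * (t * (K * lam ^+ lev (set_val x) m)) by ring.
  by rewrite !ler_pM2l//; exact: agree_dist.
apply: le_trans (_ : 3^-1 ^+ n <= _).
  apply: cantor_dist_ub; [exact: valC|exact: valC|move=> i /an h].
  exact: etrans (hf x i) (etrans h (esym (hf y i))).
apply: le_trans (ratio_bound (valA x) rb) _; rewrite ler_wpM2l//.
  by rewrite mulr_ge0 ?exprn_ge0 ?root_power_ge0// mulr_ge0 ?exprn_ge0// ltW.
apply: cantor_dist_lb; [exact: valC|exact: valC| |].
  by move=> i /am h; exact: etrans (hf x i) (etrans h (esym (hf z i))).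
by move=> h; apply: dm; exact: etrans (esym (hf x m)) (etrans h (hf z m)).
Qed.

End CodedSpace.

(** * From a tree of nested partitions to a binary code *)

Section LabelledTree.
Context {R : realType} {X : metricType R}.
(** The classes of [eqv k] have diameter and mutual distance controlled by [lam ^+ k]; the finitely
    many labels [lab k] tell the children of a class apart and so bound their number. *)
Variables (A : set X) (T : finType) (eqv : nat -> X -> X -> Prop).
Variables (lab : nat -> X -> T) (p : nat) (K : R).
Local Notation lam := (3^-1 ^+ (2 ^ p) : R).
Hypothesis K_gt0 : 0 < K.
Hypothesis eqv_refl : forall k x, eqv k x x.
Hypothesis eqv_sym : forall k x y, eqv k x y -> eqv k y x.
Hypothesis eqv_trans : forall k x y z, eqv k x y -> eqv k y z -> eqv k x z.
Hypothesis eqv0 : forall x y, A x -> A y -> eqv 0 x y.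
Hypothesis eqvS : forall k x y, eqv k.+1 x y -> eqv k x y.
Hypothesis eqv_diam : forall k x y, A x -> A y -> eqv k x y ->
  mdist x y <= K * lam ^+ k.
Hypothesis eqv_sep : forall k x y, A x -> A y -> ~ eqv k x y ->
  lam ^+ k <= K * mdist x y.
Hypothesis lab_eqv : forall k x y, A x -> A y -> eqv k.+1 x y ->
  lab k x = lab k y.
Hypothesis lab_inj : forall k x y, A x -> A y -> eqv k x y ->
  lab k x = lab k y -> eqv k.+1 x y.
Hypothesis eqv_split : forall k x, A x -> exists y,
  [/\ A y, eqv k x y & ~ eqv k.+1 x y].
Hypothesis compactA : compact A.

Definition labels k x : {set T} :=
  [set l | `[< exists y, [/\ A y, eqv k x y & lab k y = l] >]].

(** The number, from 0, of the child containing [x] among the children of its class at level [k]. *)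
Definition rank k x : nat := index (lab k x) (enum (labels k x)).

Lemma labels_eqv k x y : eqv k x y -> labels k x = labels k y.
Proof.
move=> xy; apply/setP => l; rewrite !inE; apply/asboolP/asboolP.
  by move=> [z [Az xz zl]]; exists z; split=> //; exact: eqv_trans (eqv_sym xy) xz.
by move=> [z [Az xz zl]]; exists z; split=> //; exact: eqv_trans xy xz.
Qed.

Lemma lab_labels k x : A x -> lab k x \in labels k x.
Proof. by move=> Ax; rewrite inE; apply/asboolP; exists x. Qed.

Lemma rank_lt k x : A x -> (rank k x < #|labels k x|)%N.
Proof. by move=> Ax; rewrite cardE index_mem mem_enum lab_labels. Qed.

Lemma rank_eqv k x y : A x -> A y -> eqv k.+1 x y -> rank k x = rank k y.
Proof.
move=> Ax Ay xy.
by rewrite /rank (lab_eqv Ax Ay xy) (labels_eqv (eqvS xy)).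
Qed.

Lemma rank_inj k x y : A x -> A y -> eqv k x y -> rank k x = rank k y ->
  eqv k.+1 x y.
Proof.
move=> Ax Ay xy r; apply: lab_inj => //.
rewrite -(nth_index (lab k x) (_ : lab k x \in enum (labels k x))); last first.
  by rewrite mem_enum lab_labels.
rewrite -/(rank k x) r /rank (labels_eqv xy) nth_index//.
by rewrite mem_enum lab_labels.
Qed.

Lemma rank_surj k x r : A x -> (r < #|labels k x|)%N ->
  exists y, [/\ A y, eqv k x y & rank k y = r].
Proof.
move=> Ax rc; pose l := nth (lab k x) (enum (labels k x)) r.
have : l \in labels k x by rewrite -mem_enum mem_nth// -cardE.
rewrite inE => /asboolP[y [Ay xy yl]]; exists y; split=> //.
by rewrite /rank -(labels_eqv xy) yl index_uniq ?enum_uniq// -cardE.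
Qed.

Lemma labels_ge2 k x : A x -> (2 <= #|labels k x|)%N.
Proof.
move=> Ax; have [y [Ay xy nxy]] := eqv_split k Ax.
apply/card_gt1P; exists (lab k x), (lab k y); split.
- exact: lab_labels.
- by rewrite (labels_eqv xy) lab_labels.
- by apply/eqP => e; apply: nxy; exact: lab_inj.
Qed.

(* A vertex with [c] children is spread over a binary caterpillar: the child of
   rank [r] is coded by [1^r 0] if [r < c - 1], and by [1^(c-1)] otherwise.
   State [(k, r)] means: at level [k], the ranks below [r] are excluded. *)
Fixpoint state (x : X) (n : nat) : nat * nat :=
  if n is n'.+1 then
    let: (k, r) := state x n' in
    if (rank k x == r) || (r.+2 == #|labels k x|) then (k.+1, 0%N)
    else (k, r.+1)
  else (0%N, 0%N).

Definition bit x n : bool := rank (state x n).1 x == (state x n).2.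

Definition level x n : nat := (state x n).1.

(** The rank of [x] is never excluded, and at least two ranks stay possible, so every bit is a
    genuine choice. *)
Lemma state_inv x n : A x -> ((state x n).2 <= rank (state x n).1 x)%N /\
  ((state x n).2.+2 <= #|labels (state x n).1 x|)%N.
Proof.
move=> Ax; elim: n => [|n IH] /=; first by rewrite labels_ge2.
case: (state x n) IH => k r /= [h1 h2].
case: eqVneq => [_|h3] /=; first by rewrite labels_ge2.
case: eqVneq => [_|h4] /=; first by rewrite labels_ge2.
by split; rewrite ltn_neqAle ?h1 ?h2 ?andbT// eq_sym.
Qed.

Lemma agree_state n x y : A x -> A y ->
  (forall m, (m < n)%N -> bit x m = bit y m) ->
  state x n = state y n /\ eqv (state x n).1 x y.
Proof.
move=> Ax Ay; elim: n => [_|n IH h] /=; first by split=> //; exact: eqv0.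
have [e xy] := IH (fun m mn => h m (ltnW mn)).
have := h n (ltnSn n); rewrite /bit -e.
have [] := state_inv n Ax; have [] := state_inv n Ay; rewrite -e.
move: e xy; case: (state x n) => k r /= _ xy.
rewrite -(labels_eqv xy) => ry _ rx _ bxy.
case: (eqVneq (rank k x) r) bxy => [ex|nx] /esym; case: eqVneq => //= ey _.
  by split=> //; apply: rank_inj => //; rewrite ex ey.
case: eqVneq => //= ec; split=> //; apply: rank_inj => //.
(* Only the ranks [r] and [r.+1] were left and neither point has rank [r], so both have rank
   [r.+1]. *)
have := rank_lt k Ax; have := rank_lt k Ay; rewrite -(labels_eqv xy) -ec.
by move: nx ey rx ry => /eqP nx /eqP ey; lia.
Qed.

(** Converse of [agree_state]: any point of the current class with a rank not yet excluded has
    followed the same path, so the next bit can be prescribed. *)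
Lemma state_agree n x y : A x -> A y -> eqv (state x n).1 x y ->
  ((state x n).2 <= rank (state x n).1 y)%N ->
  forall m, (m < n)%N -> bit x m = bit y m.
Proof.
move=> Ax Ay; elim: n => [//|n IH] /=.
case E : (state x n) => [k r] /= exy rxy.
have [rx rc] := state_inv n Ax; rewrite E /= in rx rc.
have [xy ry] : eqv k x y /\ (r <= rank k y)%N.
  move: exy rxy; case: ifP => /= _; last by move=> xy /ltnW.
  by move=> xy _; split; [exact: eqvS|rewrite -(rank_eqv Ax Ay xy)].
have ag : forall m, (m < n)%N -> bit x m = bit y m by apply: IH; rewrite E.
move=> m; rewrite ltnS leq_eqVlt => /predU1P[->|]; last exact: ag.
have [e _] := agree_state Ax Ay ag.
rewrite /bit -e E /=; move: exy rxy; case: ifP => /= [_ e1 _|].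
  by rewrite (rank_eqv Ax Ay e1).
by move=> /norP[/negbTE -> _] _ /gtn_eqF ->.
Qed.

Lemma bit_patterns (b : nat -> bool) n : (exists x, A x) ->
  exists2 x, A x & forall m, (m < n)%N -> bit x m = b m.
Proof.
move=> [x0 Ax0]; elim: n => [|n [x Ax hx]]; first by exists x0.
have [rx rc] := state_inv n Ax.
(* Bit [true] means rank [r]; any larger rank gives [false], and [r.+1] exists because two ranks
   remain. *)
pose r := (state x n).2; pose s := if b n then r else r.+1.
have sc : (s < #|labels (state x n).1 x|)%N.
  by rewrite /s; case: (b n) => //; exact: ltnW.
have [y [Ay xy ys]] := rank_surj Ax sc.
have rs : (r <= s)%N by rewrite /s; case: (b n).
have ag := state_agree Ax Ay xy; rewrite ys in ag.
exists y => // m; rewrite ltnS leq_eqVlt => /predU1P[->|mn]; last first.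
  by rewrite -ag// hx.
have [e _] := agree_state Ax Ay (ag rs).
rewrite /bit -e ys /s; case: (b n); first by rewrite eqxx.
by rewrite gtn_eqF.
Qed.

Lemma level_step x n i : (level x n <= level x (n + i) <= level x n + i)%N.
Proof.
elim: i => [|i IH]; first by rewrite !addn0 leqnn.
rewrite addnS /level /= in IH *.
by case: (state x (n + i)) IH => k r /=; case: ifP => /= _; lia.
Qed.

(** A level lasting [#|T|] more bits would exclude [#|T|] ranks, while two of at most [#|T|] ranks
    always remain. *)
Lemma level_grow x n i : A x -> (level x n + i <= level x (n + #|T| * i))%N.
Proof.
move=> Ax; elim: i => [|i IH]; first by rewrite muln0 !addn0.
rewrite mulnS [(#|T| + _)%N]addnC addnA addnS.
set m := (n + _)%N in IH *; apply: leq_trans (_ : level x m < _)%N; first by [].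
rewrite ltn_neqAle; have /andP[-> _] := level_step x m #|T|; rewrite andbT.
apply/eqP => e.
have stay j : (j <= #|T|)%N -> (j <= (state x (m + j)).2)%N.
  elim: j => [//|j IHj] jT; have := IHj (ltnW jT).
  have : level x (m + j) = level x (m + j.+1).
    have /andP[h1 _] := level_step x m j.
    have /andP[] := level_step x (m + j) 1; rewrite addn1 -addnS => h2 _.
    have /andP[] := level_step x (m + j.+1) (#|T| - j.+1).
    rewrite -addnA subnKC// -e => h3 _; apply/eqP; rewrite eqn_leq h2.
    exact: leq_trans h3 h1.
  rewrite /level addnS /=; case: (state x (m + j)) => k r /=.
  by case: ifP => _ /=; lia.
have [_ /leq_trans/(_ (max_card _)) h] := state_inv (m + #|T|) Ax.
by have := leq_trans (leqnSn _) h; rewrite ltnNge stay.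
Qed.

Theorem tree_qs_cantor : (exists x, A x) ->
  qs_equivalent (set_type A) (set_type (@cantor_ternary R)).
Proof.
move=> A0; have lam0 : 0 < lam by rewrite !exprn_gt0 ?invr_gt0.
have lam1 : lam <= 1.
  by rewrite exprn_ile1// ?exprn_ge0 ?invr_ge0//; lra.
(* Different bits separate points only at the next level, which costs the factor [lam]. *)
apply: (@coded_qs_cantor R X A bit level p #|T| (K / lam)) => //.
- by rewrite divr_gt0.
- exact: level_step.
- by move=> x n i; exact: level_grow.
- move=> n x y Ax Ay /(agree_state Ax Ay)[_ /(eqv_diam Ax Ay)] /le_trans; apply.
  rewrite (ler_pM2r (exprn_gt0 _ lam0)).
  by rewrite ler_pdivlMr// ler_piMr// ltW.
- move=> n x y Ax Ay /(agree_state Ax Ay)[e xy]; rewrite /bit -e => d.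
  have /(eqv_sep Ax Ay) : ~ eqv (level x n).+1 x y.
    by move=> /(rank_eqv Ax Ay) r; apply: d; rewrite r.
  rewrite exprSr => h.
  have -> : K / lam * mdist x y = (K * mdist x y) / lam by ring.
  by rewrite ler_pdivlMr.
- by move=> b n; exact: bit_patterns.
Qed.

End LabelledTree.

(** * Uniformly disconnected and uniformly perfect sets in the unit square *)

Section PlaneSets.
Context {R : realType}.
Implicit Types (A : set (eplane R)) (x y : eplane R).

(** The largest radius used later is the step [2 * lam ^+ 0] of the root class, hence the bound
    2. *)
Definition unif_perfect A : Prop := exists2 c : R, 0 < c &
  forall x r, A x -> 0 < r -> r <= 2 ->
    exists y, [/\ A y, c * r <= mdist x y & mdist x y <= r].

Lemma edistE x y : mdist x y = Defs.edist x y.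
Proof. by []. Qed.

Lemma edist1 x y : `|x.1 - y.1| <= mdist x y.
Proof. by rewrite edistE /Defs.edist -sqrtr_sqr ler_wsqrtr// lerDl sqr_ge0. Qed.

Lemma edist2 x y : `|x.2 - y.2| <= mdist x y.
Proof. by rewrite edistE /Defs.edist -sqrtr_sqr ler_wsqrtr// lerDr sqr_ge0. Qed.

Lemma edist_le x y : mdist x y <= `|x.1 - y.1| + `|x.2 - y.2|.
Proof.
rewrite edistE /Defs.edist -[leRHS]ger0_norm ?addr_ge0// -sqrtr_sqr ler_wsqrtr//.
rewrite -real_normK ?num_real// -[X in _ + X]real_normK ?num_real//.
have := normr_ge0 (x.1 - y.1); have := normr_ge0 (x.2 - y.2); nra.
Qed.

Variable A : set (eplane R).
Hypothesis A01 : forall x, A x -> (0 <= x.1 <= 1) && (0 <= x.2 <= 1).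
Hypothesis compactA : compact A.
Hypothesis A_neq0 : exists x, A x.
Hypothesis udA : unif_disconnected A.
Hypothesis upA : unif_perfect A.

Lemma square_diam x y : A x -> A y -> mdist x y <= 2.
Proof.
move=> /A01/andP[/andP[a b] /andP[c d]] /A01/andP[/andP[a' b'] /andP[c' d']].
apply: le_trans (edist_le _ _) _.
have : `|x.1 - y.1| <= 1 by rewrite ler_norml; apply/andP; split; lra.
have : `|x.2 - y.2| <= 1 by rewrite ler_norml; apply/andP; split; lra.
lra.
Qed.

Lemma truncn_close (u v : R) : 0 <= u -> 0 <= v ->
  Num.truncn u = Num.truncn v -> `|u - v| <= 1.
Proof.
move=> /truncn_itv/andP[u1 u2] /truncn_itv/andP[v1 v2] e.
rewrite e in u1 u2; rewrite -natr1 in u2 v2.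
by rewrite ler_norml; apply/andP; split; lra.
Qed.

Theorem plane_qs_cantor :
  qs_equivalent (set_type A) (set_type (@cantor_ternary R)).
Proof.
have [C C0 hC] := chain_diam udA.
have [c c0 hc] := upA.
(* This gives [C * lam < c]: a point at distance at least [c * (2 * lam ^+ k)] falls outside the
   class of level [k.+1], so every class splits. *)
have [p hp] : exists p, 3^-1 ^+ p < c / C.
  by apply: exprn_small; rewrite ?divr_gt0//; lra.
pose lam : R := 3^-1 ^+ (2 ^ p).
have lam0 : 0 < lam by rewrite exprn_gt0// invr_gt0.
have Clam : C * lam < c.
  rewrite mulrC -ltr_pdivlMr//; apply: le_lt_trans hp.
  by apply: ler_wiXn2l; [lra|lra|exact/ltnW/ltn_expl].
have lamX k : 0 < lam ^+ k by rewrite exprn_gt0.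
have lam_le1 : lam <= 1 by rewrite exprn_ile1//; lra.
pose K := 2 * C + 1.
(* The factor 2 makes all of [A] one class at level 0, and joins representatives whose two
   coordinates each differ by at most [lam ^+ k]. *)
pose eqv k x y := chain A (2 * lam ^+ k) x y.
have diam k x y : A x -> A y -> eqv k x y -> mdist x y <= C * (2 * lam ^+ k).
  by move=> Ax Ay; apply: hC => //; rewrite mulr_ge0// ltW.
have [x0 Ax0] := A_neq0.
pose rep k x := xget x0 [set y | A y /\ eqv k x y].
have repP k x : A x -> A (rep k x) /\ eqv k x (rep k x).
  by move=> Ax; apply: (@xgetPex _ x0 [set y | A y /\ eqv k x y]); exists x;
    split=> //; exact: chain_refl.
have rep_eqv k x y : eqv k x y -> rep k x = rep k y.
  move=> xy; congr xget; apply/seteqP; split=> z /= [Az xz]; split=> //.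
    exact: chain_trans (chain_sym xy) xz.
  exact: chain_trans xy xz.
have eqvS k x y : eqv k.+1 x y -> eqv k x y.
  apply: chain_le; rewrite ler_pM2l// exprS ler_piMl//; exact: ltW.
(* Representatives of a class and of its child differ by at most [M] meshes in each coordinate;
   adding [M] makes the offset nonnegative. *)
have [M hM] : exists M : nat, C * 2 / lam <= M%:R.
  exists (Num.bound (C * 2 / lam)); apply/ltW/archi_boundP.
  by rewrite divr_ge0 ?mulr_ge0// ltW.
(* A child class is labelled by the grid cell, of mesh [lam ^+ k.+1], of its
   representative relative to that of its parent. *)
pose off k (i : R) := i / lam ^+ k.+1 + M%:R.
pose cell k (i : R) : 'I_(2 * M).+1 := inord (Num.truncn (off k i)).
have off_bound k i : `|i| <= C * (2 * lam ^+ k) -> 0 <= off k i <= (2 * M)%:R.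
  move=> hi; have : `|i / lam ^+ k.+1| <= M%:R.
    apply: le_trans hM; rewrite normrM normfV [`|lam ^+ _|]gtr0_norm//.
    rewrite ler_pdivrMr// exprS.
    by apply: le_trans hi _; rewrite mulrA mulrA divfK ?gt_eqF// mulrA.
  rewrite ler_norml natrM /off => /andP[h1 h2]; apply/andP; split; lra.
have cell_close k i j : `|i| <= C * (2 * lam ^+ k) ->
    `|j| <= C * (2 * lam ^+ k) -> cell k i = cell k j ->
    `|i - j| <= lam ^+ k.+1.
  move=> /off_bound/andP[i0 iM] /off_bound/andP[j0 jM] /(congr1 val) /=.
  have lt (u : R) : 0 <= u -> u <= (2 * M)%:R -> (Num.truncn u < (2 * M).+1)%N.
    by move=> u0 uM; rewrite truncn_lt_nat// (le_lt_trans uM)// ltr_nat.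
  rewrite !inordK ?lt// => /(truncn_close i0 j0).
  rewrite /off opprD addrACA subrr addr0 -mulrBl normrM normfV.
  by rewrite [`|lam ^+ _|]gtr0_norm// ler_pdivrMr// mul1r.
pose lab k x := (cell k ((rep k.+1 x).1 - (rep k x).1),
                 cell k ((rep k.+1 x).2 - (rep k x).2)).
have eqv_trans k x y z : eqv k x y -> eqv k y z -> eqv k x z.
  exact: chain_trans.
have eqv_sym k x y : eqv k x y -> eqv k y x by exact: chain_sym.
have rep_dist k x : A x -> mdist (rep k.+1 x) (rep k x) <= C * (2 * lam ^+ k).
  move=> Ax; have [Ar xr] := repP k x Ax; have [Ar' xr'] := repP k.+1 x Ax.
  by apply: diam => //; exact: eqv_trans (eqv_sym _ _ _ (eqvS _ _ _ xr')) xr.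
apply: (@tree_qs_cantor R (eplane R) A _ eqv lab p K) => //.
- by rewrite /K addr_gt0// mulr_gt0.
- by move=> k x; exact: chain_refl.
- by move=> x y Ax Ay; apply: chain_step => //; rewrite expr0 mulr1 square_diam.
- move=> k x y Ax Ay /(diam k x y Ax Ay)/le_trans; apply.
  rewrite mulrA ler_pM2r//; rewrite /K; lra.
- move=> k x y Ax Ay nxy.
  have : 2 * lam ^+ k < mdist x y.
    by rewrite ltNge; apply/negP => h; apply: nxy; exact: chain_step.
  move=> h; have := lamX k; have : 0 <= C * mdist x y.
    by rewrite mulr_ge0 ?mdist_ge0// ltW.
  by rewrite /K -/lam; have := mdist_ge0 x y; nra.
- move=> k x y Ax Ay xy.
  by rewrite /lab (rep_eqv _ _ _ xy) (rep_eqv _ _ _ (eqvS _ _ _ xy)).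
- move=> k x y Ax Ay xy [e1 e2].
  rewrite -(rep_eqv _ _ _ xy) in e1 e2.
  have [Ax' xx'] := repP k.+1 x Ax; have [Ay' yy'] := repP k.+1 y Ay.
  have dx := rep_dist k x Ax; have dy := rep_dist k y Ay.
  rewrite -(rep_eqv _ _ _ xy) in dy.
  have h1 := cell_close _ _ _ (le_trans (edist1 _ _) dx)
    (le_trans (edist1 _ _) dy) e1.
  have h2 := cell_close _ _ _ (le_trans (edist2 _ _) dx)
    (le_trans (edist2 _ _) dy) e2.
  apply: chain_trans xx' _; apply: chain_trans (eqv_sym _ _ _ yy').
  apply: chain_step => //; apply: le_trans (edist_le _ _) _.
  rewrite !opprB !addrA !subrK in h1 h2.
  by rewrite mulr_natl mulr2n lerD.
- move=> k x Ax; have lk1 : lam ^+ k <= 1 by rewrite exprn_ile1// ltW.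
  have r0 : 0 < 2 * lam ^+ k by rewrite mulr_gt0.
  have [|y [Ay cy yr]] := hc x (2 * lam ^+ k) Ax r0; first by lra.
  exists y; split=> //; first exact: chain_step.
  move=> /(diam k.+1 x y Ax Ay); apply/negP; rewrite -ltNge.
  apply: lt_le_trans cy; rewrite exprS.
  have -> : C * (2 * (lam * lam ^+ k)) = (C * lam) * (2 * lam ^+ k) by ring.
  by rewrite ltr_pM2r.
Qed.

End PlaneSets.

(** * Lalley-Gatzouras sets *)

Lemma lipschitz_continuous (R : realType) (X : metricType R) (f : X -> R) :
  (forall p q, `|f p - f q| <= mdist p q) -> continuous f.
Proof.
move=> lf p; apply/cvgrPdist_lt => e e0.
have : nbhs p (ball p e) by exact: nbhsx_ballx.
by apply: filterS => q; rewrite ballEmdist/=; exact: le_lt_trans.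
Qed.

Lemma pos_lower_bound (R : realType) (I : finType) (f : I -> R) :
  (forall i, 0 < f i) -> exists m, [/\ 0 < m, m <= 1 & forall i, m <= f i].
Proof.
move=> f0; suff [m [m0 m1 hm]] : exists m, [/\ 0 < m, m <= 1 &
    forall i, i \in enum I -> m <= f i].
  by exists m; split=> // i; apply: hm; rewrite mem_enum.
elim: (enum I) => [|i s [m [m0 m1 hm]]]; first by exists 1; split.
exists (Num.min (f i) m); split; first by rewrite lt_min f0.
  by rewrite ge_min m1 orbT.
move=> j; rewrite inE => /predU1P[->|js]; first by rewrite ge_min lexx.
by rewrite ge_min hm// orbT.
Qed.

Section LGBasics.
Context {R : realType} (L : LGdata R).
Local Notation D := (lg_D L).
Implicit Types (ij : D) (i : 'I_(lg_m L)).

Definition Da ij : R := lg_a (tagged ij).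
Definition Dc ij : R := lg_c (tagged ij).
Definition Db ij : R := lg_b (tag ij).
Definition Dd ij : R := lg_d (tag ij).

Lemma lg_S1 ij p : (lg_S ij p).1 = Da ij * p.1 + Dc ij. Proof. by []. Qed.
Lemma lg_S2 ij p : (lg_S ij p).2 = Db ij * p.2 + Dd ij. Proof. by []. Qed.

Lemma lg_c_lt i (j k : 'I_(lg_n i)) : (j < k)%N -> lg_c j + lg_a j <= lg_c k.
Proof.
case: k => k kn /= jk; elim: k kn jk => // k IH kn.
rewrite ltnS leq_eqVlt => /predU1P[jk|jk].
  have := @lg_c_step _ L i j (Ordinal kn); rewrite /= jk => /(_ erefl).
  lra.
have h := IH (ltnW kn) jk.
have := @lg_c_step _ L i (Ordinal (ltnW kn)) (Ordinal kn) erefl.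
have [] := @lg_ab _ L i (Ordinal (ltnW kn)); lra.
Qed.

Lemma lg_ca_le1 i (j : 'I_(lg_n i)) : lg_c j + lg_a j <= 1.
Proof.
have n0 : (0 < lg_n i)%N by case: j => j; exact: leq_ltn_trans.
have ln : ((lg_n i).-1 < lg_n i)%N by rewrite prednK.
have [jl|jl] := ltnP j (lg_n i).-1.
  have := @lg_c_lt i j (Ordinal ln) jl.
  have := @lg_c_last _ L i (Ordinal ln) (prednK n0).
  have [] := @lg_ab _ L i (Ordinal ln); lra.
have := @lg_c_last _ L i j; move=> /(_ _)/wrap[]; last lra.
by have := ltn_ord j; lia.
Qed.

Lemma sum_b_le (P Q : pred 'I_(lg_m L)) : (forall i, P i -> Q i) ->
  \sum_(i | P i) lg_b i <= \sum_(i | Q i) lg_b i.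
Proof.
move=> PQ; rewrite [leLHS]big_mkcond [leRHS]big_mkcond; apply: ler_sum => i _.
by case: ifP => [/PQ ->//|_]; case: ifP => // _; exact/ltW/lg_b_gt0.
Qed.

Lemma lg_d_ge0 i : 0 <= lg_d i.
Proof. by apply: sumr_ge0 => k _; exact/ltW/lg_b_gt0. Qed.

Lemma lg_db i : lg_d i + lg_b i = \sum_(k < lg_m L | (k <= i)%N) lg_b k.
Proof.
rewrite [RHS](bigD1 i)//= addrC; congr (_ + _); apply: eq_bigl => k.
by rewrite ltn_neqAle andbC.
Qed.

Lemma lg_d_lt i (k : 'I_(lg_m L)) : (i < k)%N -> lg_d i + lg_b i <= lg_d k.
Proof.
by move=> ik; rewrite lg_db; apply: sum_b_le => l li; exact: leq_ltn_trans ik.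
Qed.

Lemma lg_db_le1 i : lg_d i + lg_b i <= 1.
Proof. by rewrite lg_db -(lg_b_sum1 L); exact: sum_b_le. Qed.

Lemma lg_b_lt1 i : lg_b i < 1.
Proof.
have [k ki] : exists k, k != i.
  have m2 := lg_m_ge2 L; have m0 := ltnW m2.
  have [e|] := eqVneq (Ordinal m0) i; last by exists (Ordinal m0).
  by exists (Ordinal m2); rewrite -e.
rewrite -(lg_b_sum1 L) (bigD1 i)//= (bigD1 k)//= ltrDl ltr_wpDr ?lg_b_gt0//.
by apply: sumr_ge0 => l _; exact/ltW/lg_b_gt0.
Qed.

Lemma Da_gt0 ij : 0 < Da ij. Proof. by have [] := lg_ab (tagged ij). Qed.
Lemma Da_lt_Db ij : Da ij < Db ij. Proof. by have [] := lg_ab (tagged ij). Qed.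
Lemma Db_gt0 ij : 0 < Db ij. Proof. exact: lg_b_gt0. Qed.
Lemma Db_lt1 ij : Db ij < 1. Proof. exact: lg_b_lt1. Qed.
Lemma Dc_ge0 ij : 0 <= Dc ij. Proof. exact: lg_c_ge0. Qed.
Lemma Dd_ge0 ij : 0 <= Dd ij. Proof. exact: lg_d_ge0. Qed.
Lemma Dca_le1 ij : Dc ij + Da ij <= 1. Proof. exact: lg_ca_le1. Qed.
Lemma Ddb_le1 ij : Dd ij + Db ij <= 1. Proof. exact: lg_db_le1. Qed.

Lemma contraction_bounds : exists mu q : R, [/\ 0 < mu, mu <= 1, q < 1,
  forall i, mu <= lg_b i <= q & forall ij, mu <= Da ij].
Proof.
have [m1 [m10 m11 hm1]] := pos_lower_bound (@lg_b_gt0 _ L).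
have [m2 [m20 m21 hm2]] := pos_lower_bound Da_gt0.
have h i : 0 < 1 - lg_b i by rewrite subr_gt0 lg_b_lt1.
have [m3 [m30 m31 hm3]] := pos_lower_bound h.
exists (Num.min m1 m2), (1 - m3); split.
- by rewrite lt_min m10.
- by rewrite ge_min m11.
- lra.
- by move=> i; rewrite ge_min hm1 /=; have := hm3 i; lra.
- by move=> ij; rewrite ge_min hm2 orbT.
Qed.

Variable E : set (eplane R).
Hypothesis hE : lalley_gatzouras_set L E.

Lemma LG_in ij p : E p -> E (lg_S ij p).
Proof. by move=> Ep; case: hE => _ _ ->; exists ij => //; exists p. Qed.

Lemma LG_out p : E p -> exists ij q, E q /\ p = lg_S ij q.
Proof.
by case: hE => _ _ {1}-> [ij _ [q Eq <-]]; exists ij, q.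
Qed.

Lemma LG_neq0 : E !=set0. Proof. by case: hE. Qed.
Lemma LG_compact : compact E. Proof. by case: hE. Qed.

(** At a minimum of [f] on [E], [f p = a * f q + c] gives [min >= a * min], hence [min >= 0]; a
    maximum gives [max <= a * max + (1 - a)], hence [max <= 1]. *)
Lemma self_affine_coord01 (f : eplane R -> R) :
  (forall p q, `|f p - f q| <= mdist p q) ->
  (forall p, E p -> exists q (a c : R), [/\ E q, f p = a * f q + c &
    [/\ 0 < a, a < 1, 0 <= c & c + a <= 1]]) ->
  forall p, E p -> 0 <= f p <= 1.
Proof.
move=> lf hf p Ep.
have cf : {within E, continuous f}.
  exact/continuous_subspaceT/lipschitz_continuous.
have [x /set_mem Ex xmax] := compact_EVT_max LG_neq0 LG_compact cf.
have [y /set_mem Ey ymin] := compact_EVT_min LG_neq0 LG_compact cf.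
apply/andP; split.
  apply: le_trans (ymin _ (mem_set Ep)).
  have [q [a [c [Eq e [a0 a1 c0 _]]]]] := hf y Ey.
  by have := ymin _ (mem_set Eq); rewrite e; nra.
apply: le_trans (xmax _ (mem_set Ep)) _.
have [q [a [c [Eq e [a0 a1 _ ca]]]]] := hf x Ex.
by have := xmax _ (mem_set Eq); nra.
Qed.

Lemma LG01 p : E p -> (0 <= p.1 <= 1) && (0 <= p.2 <= 1).
Proof.
move=> Ep; apply/andP; split.
  apply: (@self_affine_coord01 (fun p => p.1)) Ep; first exact: edist1.
  move=> _ /LG_out[ij [q [Eq ->]]]; exists q, (Da ij), (Dc ij); split=> //.
  split; [exact: Da_gt0| |exact: Dc_ge0|exact: Dca_le1].
  exact: lt_trans (Da_lt_Db _) (Db_lt1 _).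
apply: (@self_affine_coord01 (fun p => p.2)) Ep; first exact: edist2.
move=> _ /LG_out[ij [q [Eq ->]]]; exists q, (Db ij), (Dd ij); split=> //.
by split; [exact: Db_gt0|exact: Db_lt1|exact: Dd_ge0|exact: Ddb_le1].
Qed.

Lemma LG01_1 p : E p -> 0 <= p.1 <= 1. Proof. by move=> /LG01/andP[]. Qed.
Lemma LG01_2 p : E p -> 0 <= p.2 <= 1. Proof. by move=> /LG01/andP[]. Qed.

End LGBasics.

(** * Uniform perfectness *)

Section LGPerfect.
Context {R : realType} (L : LGdata R) (E : set (eplane R)).
Hypothesis hE : lalley_gatzouras_set L E.
Local Notation D := (lg_D L).

(** Distinct rows, or distinct columns of a row, do not overlap: a common fixed point would have a
    coordinate at least 1 by one map and at most 0 by the other. *)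
Lemma lg_S_common_fixpoint (ij kl : D) (p : eplane R) : E p ->
  lg_S ij p = p -> lg_S kl p = p -> ij = kl.
Proof.
move=> Ep fij fkl; have /andP[/andP[x0 x1] /andP[y0 y1]] := LG01 hE Ep.
have e1 := congr1 fst fij; have e2 := congr1 snd fij.
have e3 := congr1 fst fkl; have e4 := congr1 snd fkl.
have tag_le (a b : D) : lg_S a p = p -> lg_S b p = p -> ~ (tag a < tag b)%N.
  move=> /(congr1 snd)/= ea /(congr1 snd)/= eb /lg_d_lt.
  have := lg_b_gt0 (tag a); have := lg_b_gt0 (tag b) => hb ha hab.
  have : lg_b (tag b) * p.2 <= 0 by nra.
  have : lg_b (tag a) * (1 - p.2) <= 0 by nra.
  by rewrite !pmulr_rle0//; lra.
have et : tag ij = tag kl.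
  case: (ltngtP (tag ij) (tag kl)) => [h|h|/ord_inj//].
    by case: (tag_le ij kl).
  by case: (tag_le kl ij).
case: ij kl et e1 e3 {fij fkl e2 e4 tag_le} => i j [k l] /= ik.
subst k => e1 e3; congr existT.
have col_le (a b : 'I_(lg_n i)) : lg_a a * p.1 + lg_c a = p.1 ->
    lg_a b * p.1 + lg_c b = p.1 -> ~ (a < b)%N.
  move=> ea eb /lg_c_lt; have [ha _ _] := lg_ab a; have [hb _ _] := lg_ab b => hab.
  have : lg_a b * p.1 <= 0 by nra.
  have : lg_a a * (1 - p.1) <= 0 by nra.
  by rewrite !pmulr_rle0//; lra.
case: (ltngtP j l) => [h|h|/ord_inj//].
  by case: (col_le j l).
by case: (col_le l j).
Qed.

Lemma LG_two_points : (1 < #|D|)%N -> exists p q, [/\ E p, E q & p <> q].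
Proof.
move=> /card_gt1P[ij [kl [_ _ /eqP ne]]]; have [p Ep] := LG_neq0 hE.
apply: contrapT => h; apply: ne.
have fix_p (a : D) : lg_S a p = p.
  apply: contrapT => ne; apply: h; exists (lg_S a p), p.
  by split; [exact: LG_in|exact: Ep|].
exact: lg_S_common_fixpoint Ep (fix_p _) (fix_p _).
Qed.

(** [E] may lie on an axis-parallel line, so [W] is 0 for a constant coordinate and 1 otherwise. Of
    two distinct values, one is at least half their distance away from any given value. *)
Lemma coord_spread (f : eplane R -> R) : (forall p, E p -> 0 <= f p <= 1) ->
  exists W t : R, [/\ 0 < t, W = 0 \/ W = 1,
    (forall p q, E p -> E q -> `|f p - f q| <= W),
    (forall p, E p -> exists2 q, E q & t * W <= `|f p - f q|) &
    (exists p q, [/\ E p, E q & f p <> f q]) -> W = 1].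
Proof.
move=> f01; have [[p [q [Ep Eq ne]]]|h] :=
  pselect (exists p q, [/\ E p, E q & f p <> f q]); last first.
  have e0 p q : E p -> E q -> `|f p - f q| = 0.
    move=> Ep Eq; apply/eqP; rewrite normr_eq0 subr_eq0; apply/eqP.
    by apply: contrapT => ne; apply: h; exists p, q.
  exists 0, 1; split=> //; first by left.
  - by move=> p q Ep Eq; rewrite e0.
  - by move=> p Ep; exists p => //; rewrite e0// mulr0.
have t0 : 0 < `|f p - f q| by rewrite normr_gt0 subr_eq0; apply/eqP.
exists 1, (`|f p - f q| / 2); split=> //; first by rewrite divr_gt0.
- by right.
- move=> x y /f01/andP[a b] /f01/andP[c d].
  by rewrite ler_norml; apply/andP; split; lra.
- move=> x Ex; rewrite mulr1; have := ler_distD (f x) (f p) (f q).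
  rewrite [X in _ <= X + _]distrC => tri.
  have [h|h] := leP (`|f p - f q| / 2) `|f x - f p|; first by exists p.
  by exists q => //; lra.
Qed.

Lemma LG_unif_perfect : (1 < #|D|)%N -> unif_perfect E.
Proof.
move=> /LG_two_points[p0 [q0 [Ep0 Eq0 ne0]]].
have [mu [q [mu0 mu1 q1 hb ha]]] := contraction_bounds L.
have [W [s [s0 W01 Wub Wlb Wne]]] := coord_spread (LG01_1 hE).
have [H [t [t0 H01 Hub Hlb Hne]]] := coord_spread (LG01_2 hE).
pose th := Num.min s t.
have th0 : 0 < th by rewrite lt_min s0.
have [ths tht] : th <= s /\ th <= t by rewrite !ge_min !lexx orbT.
have W0 : 0 <= W by case: W01 => ->.
have H0 : 0 <= H by case: H01 => ->.
have q0' : 0 <= q.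
  have [ij _] := LG_out hE Ep0.
  by have /andP[_] := hb (tag ij); apply: le_trans; exact/ltW/lg_b_gt0.
(* A cylinder of E is E with the axes rescaled by [al] and [be], so the induction
   runs over rescaled copies; [max (al * W) (be * H)] is the size of the copy. *)
have term al be r x : 0 < al -> 0 < be -> 0 < r -> E x ->
    mu * r <= Num.max (al * W) (be * H) -> Num.max (al * W) (be * H) <= r ->
    exists y, [/\ E y,
      th * mu * r <= Num.max (al * `|x.1 - y.1|) (be * `|x.2 - y.2|) &
      al * `|x.1 - y.1| <= r /\ be * `|x.2 - y.2| <= r].
  move=> al0 be0 r0 Ex lo; rewrite ge_max => /andP[hW hH].
  have ub y : E y -> al * `|x.1 - y.1| <= r /\ be * `|x.2 - y.2| <= r.
    move=> Ey; split; [apply: le_trans hW|apply: le_trans hH].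
      by rewrite ler_pM2l// Wub.
    by rewrite ler_pM2l// Hub.
  move: lo; rewrite le_max => /orP[lo|lo].
    have [y Ey hy] := Wlb x Ex; exists y; split; [by []| |exact: ub].
    rewrite le_max; apply/orP; left.
    apply: (@le_trans _ _ (th * (al * W))); first by rewrite -mulrA ler_pM2l.
    rewrite mulrCA ler_pM2l//; apply: le_trans hy.
    by rewrite ler_wpM2r.
  have [y Ey hy] := Hlb x Ex; exists y; split; [by []| |exact: ub].
  rewrite le_max; apply/orP; right.
  apply: (@le_trans _ _ (th * (be * H))); first by rewrite -mulrA ler_pM2l.
  rewrite mulrCA ler_pM2l//; apply: le_trans hy.
  by rewrite ler_wpM2r.
(* Passing to a cylinder around [x] multiplies the size by a factor between [mu] and [q], so the
   first size at most [r] is still at least [mu * r]. *)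
have main n : forall al be r x, 0 < al -> 0 < be -> 0 < r -> E x ->
    mu * r <= Num.max (al * W) (be * H) ->
    Num.max (al * W) (be * H) * q ^+ n <= r ->
    exists y, [/\ E y,
      th * mu * r <= Num.max (al * `|x.1 - y.1|) (be * `|x.2 - y.2|) &
      al * `|x.1 - y.1| <= r /\ be * `|x.2 - y.2| <= r].
  elim: n => [|n IH] al be r x al0 be0 r0 Ex lo hi; last first.
    have [wr|rw] := leP (Num.max (al * W) (be * H)) r; last first.
      have [ij [x' [Ex' ex]]] := LG_out hE Ex.
      have am := ha ij; have /andP[bm bq] := hb (tag ij).
      have ab := Da_lt_Db ij.
      have [||||||y [Ey ylo [y1 y2]]] := IH (al * Da ij) (be * Db ij) r x'.
      - by rewrite mulr_gt0 ?Da_gt0.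
      - by rewrite mulr_gt0 ?Db_gt0.
      - exact: r0.
      - exact: Ex'.
      - apply: (@le_trans _ _ (mu * Num.max (al * W) (be * H))).
          by rewrite ler_pM2l// ltW.
        rewrite maxr_pMr ?(ltW mu0)// ge_max !le_max; apply/andP; split; apply/orP.
          left; rewrite mulrCA mulrA ler_wpM2r// ler_pM2l//.
        right; rewrite mulrCA mulrA ler_wpM2r// ler_pM2l//.
      - apply: le_trans hi; rewrite exprS mulrA ler_wpM2r ?exprn_ge0//.
        rewrite maxr_pMl// ge_max !le_max; apply/andP; split; apply/orP.
          left; rewrite mulrAC; apply: ler_wpM2l.
            by rewrite mulr_ge0// ltW.
          exact/ltW/(lt_le_trans ab bq).
        by right; rewrite mulrAC ler_wpM2l// mulr_ge0// ltW.
      have d1 : `|x.1 - (lg_S ij y).1| = Da ij * `|x'.1 - y.1|.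
        rewrite ex !lg_S1 opprD addrACA subrr addr0 -mulrBr normrM gtr0_norm//.
        exact: Da_gt0.
      have d2 : `|x.2 - (lg_S ij y).2| = Db ij * `|x'.2 - y.2|.
        rewrite ex !lg_S2 opprD addrACA subrr addr0 -mulrBr normrM gtr0_norm//.
        exact: Db_gt0.
      exists (lg_S ij y); rewrite d1 d2 !mulrA; split=> //.
      exact: (LG_in hE).
    exact: term.
  by apply: term => //; rewrite expr0 mulr1 in hi.
exists (th * mu / 2); first by rewrite !mulr_gt0// invr_gt0.
move=> x r Ex r1 r2.
have WH : Num.max (1 * W) (1 * H) = 1.
  rewrite !mul1r; apply/eqP; rewrite eq_le ge_max le_max.
  have le1 (V : R) : V = 0 \/ V = 1 -> V <= 1 by case=> ->; rewrite ?ler01.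
  rewrite !le1//=; apply/orP.
  have [/eqP e1|ne1] := eqVneq p0.1 q0.1; last first.
    by left; rewrite Wne//; exists p0, q0; split=> //; exact/eqP.
  right; rewrite Hne//; exists p0, q0; split=> // e2; apply: ne0.
  by move: e1 e2; case: (p0) (q0) => [? ?] [? ?] /= /eqP -> ->.
(* Each coordinate gets [r / 2], since the distance is bounded by the sum of both differences. *)
have r20 : 0 < r / 2 by rewrite divr_gt0.
have [n hn] := exprn_small q0' q1 r20.
have [||||y [Ey lo [h1 h2]]] := main n 1 1 (r / 2) x ltr01 ltr01.
- exact: r20.
- exact: Ex.
- rewrite WH; have : r / 2 <= 1 by lra.
  nra.
- by rewrite WH mul1r ltW.
exists y; rewrite !mul1r in lo h1 h2; split=> //.
  have -> : th * mu / 2 * r = th * mu * (r / 2) by ring.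
  by apply: le_trans lo _; rewrite ge_max edist1 edist2.
by apply: le_trans (edist_le _ _) _; lra.
Qed.
End LGPerfect.

(** * Holes at every scale *)

Section Moran.
Context {R : realType}.
Variables (K : Type) (I : K -> Type) (al ga : forall k, I k -> R) (q : K -> R).
Variables mu h : R.
Hypothesis mu_gt0 : 0 < mu.
Hypothesis mu_le1 : mu <= 1.
Hypothesis h_gt0 : 0 < h.
Hypothesis h_le1 : h <= 1.
Hypothesis al_bounds : forall k (i : I k), mu <= al i <= q k.
Hypothesis ga_bounds : forall k (i : I k), 0 <= ga i /\ ga i + al i <= 1.
Hypothesis disj : forall k (i j : I k),
  [\/ i = j, ga i + al i <= ga j | ga j + al j <= ga i].
Hypothesis hole : forall k, exists g, [/\ 0 <= g, g + h <= 1 &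
  forall i : I k, ga i + al i <= g \/ g + h <= ga i].

(** Finite stage of a Moran construction whose step of type [k] uses the pieces [I k]. Row words
    give the horizontal extent of strips; a constant word gives the projection to the y axis. *)
Fixpoint moran (l : seq K) (x : R) : Prop :=
  if l is k :: l' then exists (i : I k) y, moran l' y /\ x = al i * y + ga i
  else 0 <= x <= 1.

Let al_gt0 k (i : I k) : 0 < al i.
Proof. by have /andP[+ _] := al_bounds i; exact: lt_le_trans. Qed.

Lemma moran01 l x : moran l x -> 0 <= x <= 1.
Proof.
elim: l x => [//|k l IH] x [i [y [/IH/andP[y0 y1] ->]]].
have [g0 g1] := ga_bounds i; have a0 := al_gt0 i.
by apply/andP; split; nra.
Qed.

(* [h * mu / 3] is the relative size of a hole inside an interval of length
   [s]: zoom in at a point of the middle third until the interval has length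
   between [3] and [3 / mu], hence contains [0, 1]. *)
Lemma moran_hole_at l u s y : 0 < s -> s <= 3 / mu ->
  3 * \prod_(k <- l) q k < mu * s ->
  moran l y -> u + s / 3 <= y -> y <= u + 2 * s / 3 ->
  exists g, [/\ u <= g, g + h * mu / 3 * s <= u + s,
    0 <= g, g + h * mu / 3 * s <= 1 &
    forall z, moran l z -> z <= g \/ g + h * mu / 3 * s <= z].
Proof.
rewrite ler_pdivlMr//.
(* The product bound says that the word is long enough: for the empty word it contradicts
   [s * mu <= 3]. *)
elim: l u s y => [|k l IH] u s y s0 s3; first by rewrite big_nil; lra.
rewrite big_cons => hq My uy yu; have /andP[y0 y1] := moran01 My.
have es : h * mu / 3 * s <= h.
  by have := ler_wpM2l (ltW h_gt0) s3; lra.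
(* For [s >= 3] an interval with a point of [[0, 1]] in its middle third contains [[0, 1]], so the
   hole of the first step serves. *)
have [s3'|s3'] := ltP s 3; last first.
  have [g [g0 g1 hg]] := hole k; exists g; split; try lra.
  move=> z [i [z' [/moran01/andP[z0 z1] ->]]]; have a0 := al_gt0 i.
  by case: (hg i) => hi; [left|right]; nra.
case: My => i [y' [My' ey]]; have a0 := al_gt0 i.
have /andP[amu aq] := al_bounds i; have [c0 c1] := ga_bounds i.
have [e1 e2] : u = al i * ((u - ga i) / al i) + ga i /\ s = al i * (s / al i).
  by split; field; rewrite gt_eqF.
move: e1 e2; move: (_ / al i) (s / al i) => u' s' e1 e2.
have s'0 : 0 < s' by rewrite e2 pmulr_rgt0 in s0.
have [|||||g [h1 h2 h3 h4 h5]] := IH u' s' y' s'0.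
- apply: (@le_trans _ _ (s' * al i)); last by rewrite mulrC -e2 ltW.
  by rewrite ler_pM2l.
- have q0 : 0 < q k by exact: lt_le_trans aq.
  rewrite -(ltr_pM2l q0) mulrCA; apply: lt_le_trans hq _.
  by rewrite e2 mulrCA; apply: ler_wpM2r => //; rewrite mulr_ge0// ltW.
- exact: My'.
- rewrite -(ler_pM2l a0) -(lerD2r (ga i)) -ey; apply: le_trans uy.
  rewrite e1 e2; lra.
- rewrite -(ler_pM2l a0) -(lerD2r (ga i)) -ey; apply: (le_trans yu).
  rewrite e1 e2; lra.
exists (al i * g + ga i).
have -> : al i * g + ga i + h * mu / 3 * s =
  al i * (g + h * mu / 3 * s') + ga i by rewrite e2; ring.
set g' := g + _ in h2 h4 h5 *; split; try nra.
move=> z [j [z' [Mz ->]]]; have /andP[z0 z1] := moran01 Mz.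
have b0 := al_gt0 j.
(* The hole lies inside the piece [i], so the other pieces stay on one side of it. *)
have [ij|ji|ij] := disj i j.
- subst j; case: (h5 _ Mz) => hz; [left|right]; nra.
- right; nra.
- left; nra.
Qed.

(** If the middle third contains no point of the set, it is itself a large enough hole. *)
Lemma moran_hole l u s : 0 < s -> s <= 3 / mu ->
  3 * \prod_(k <- l) q k < mu * s ->
  exists g, [/\ u <= g, g + h * mu / 3 * s <= u + s &
    forall z, moran l z -> z <= g \/ g + h * mu / 3 * s <= z].
Proof.
move=> s0 s3 hq.
have [[y [My uy yu]]|ne] := pselect (exists y,
    [/\ moran l y, u + s / 3 <= y & y <= u + 2 * s / 3]).
  by have [g [h1 h2 _ _ h5]] := moran_hole_at s0 s3 hq My uy yu; exists g.
have hm : h * mu <= 1 by rewrite mulr_ile1// ltW.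
have es : h * mu / 3 * s <= s / 3.
  by have := ler_wpM2r (ltW s0) hm; lra.
exists (u + s / 3); split; try lra.
move=> z Mz; apply: contrapT => /not_orP[/negP h1 /negP h2].
apply: ne; exists z; rewrite -!ltNge in h1 h2; split=> //; lra.
Qed.

End Moran.

(** * Row holes, and strips of cylinders with a common row word *)

Section LGStrips.
Context {R : realType} (L : LGdata R) (E : set (eplane R)).
Hypothesis hE : lalley_gatzouras_set L E.
Local Notation row := 'I_(lg_m L).

Definition full_cover (i : row) : Prop := forall x : R, 0 <= x < 1 ->
  exists j : 'I_(lg_n i), lg_c j <= x < lg_c j + lg_a j.

(** Sweep the columns from the left: while no gap occurs, the first [k] of them cover an interval
    [[0, e)] and the others start at [e] or later. A row without hole ends with [e >= 1]. *)
Lemma row_hole (i : row) : ~ full_cover i ->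
  exists g h, [/\ 0 < h, 0 <= g, g + h <= 1 &
    forall j : 'I_(lg_n i), lg_c j + lg_a j <= g \/ g + h <= lg_c j].
Proof.
move=> nfull; apply: contrapT => nohole; apply: nfull.
have a0 (j : 'I_(lg_n i)) : 0 < lg_a j by have [] := lg_ab j.
have packed k : (k <= lg_n i)%N -> exists e, [/\ 0 <= e,
    forall x : R, 0 <= x < e ->
      exists j : 'I_(lg_n i), lg_c j <= x < lg_c j + lg_a j,
    forall j : 'I_(lg_n i), (j < k)%N -> lg_c j + lg_a j <= e &
    forall j : 'I_(lg_n i), (k <= j)%N -> e <= lg_c j].
  elim: k => [_|k IH kn].
    exists 0; split=> //; first by move=> x /andP[/le_lt_trans h /h]; rewrite ltxx.
    by move=> j _; exact: lg_c_ge0.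
  have [e [e0 ex eu el]] := IH (ltnW kn); pose j := Ordinal kn.
  have [h|h] := ltP e (lg_c j).
    case: nohole; exists e, (lg_c j - e); split=> //; first by rewrite subr_gt0.
      by have := lg_ca_le1 j; have := a0 j; lra.
    move=> l; have [lk|] := ltnP l k; first by left; exact: eu.
    rewrite leq_eqVlt => /predU1P[kl|kl]; right; rewrite addrC subrK.
      by have -> : l = j by apply: ord_inj.
    by have := @lg_c_lt _ L i j l kl; have := a0 j; lra.
  exists (lg_c j + lg_a j); split.
  - by rewrite addr_ge0 ?lg_c_ge0// ltW.
  - move=> x /andP[x0 xj]; have [xe|xe] := ltP x e; first by apply: ex; rewrite x0.
    by exists j; rewrite xj (le_trans h).
  - move=> l; rewrite ltnS leq_eqVlt => /predU1P[lk|lk].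
      by have -> : l = j by apply: ord_inj.
    by have := eu l lk; have := el j (leqnn k); have := a0 j; lra.
  - by move=> l kl; exact: lg_c_lt.
have [e [e0 ex eu _]] := packed _ (leqnn _).
have [e1|e1] := ltP e 1; last first.
  by move=> x /andP[x0 x1]; apply: ex; rewrite x0 (lt_le_trans x1).
exfalso; apply: nohole; exists e, (1 - e); split=> //.
- by rewrite subr_gt0.
- by rewrite addrC subrK.
- by move=> j; left; exact: eu.
Qed.

(** The cylinders with row word [w] and free columns: they share their vertical range, while their
    horizontal positions form a Moran stage. *)
Fixpoint strip (w : seq row) (p : eplane R) : Prop :=
  if w is i :: w' then
    exists (j : 'I_(lg_n i)) q,
      strip w' q /\ p = lg_S (Tagged (fun i => 'I_(lg_n i)) j) q
  else E p.

Fixpoint strip_lo (w : seq row) : R :=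
  if w is i :: w' then lg_b i * strip_lo w' + lg_d i else 0.

Local Notation height w := (\prod_(i <- w) lg_b i).

(* [w] is the shortest prefix, along its row word, of height less than [t]. *)
Fixpoint stop (t : R) (w : seq row) : Prop :=
  if w is i :: w' then t <= 1 /\ stop (t / lg_b i) w' else 1 < t.

Lemma strip_lo01 w : 0 <= strip_lo w /\ strip_lo w + height w <= 1.
Proof.
elim: w => [|i w [IH1 IH2]] /=; first by rewrite big_nil add0r.
rewrite big_cons; have := lg_d_ge0 i; have := lg_db_le1 i.
have b0 := lg_b_gt0 i; split; nra.
Qed.

Lemma strip_range w p : strip w p ->
  strip_lo w <= p.2 /\ p.2 <= strip_lo w + height w.
Proof.
elim: w p => [p /(LG01_2 hE)/andP[]|i w IH p [j [q [/IH[h1 h2] ->]]]] /=.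
  by rewrite big_nil add0r.
have b0 := lg_b_gt0 i.
by rewrite big_cons; split; nra.
Qed.

Lemma stop_cover (t : R) p : 0 < t -> E p -> exists w, stop t w /\ strip w p.
Proof.
move=> t0 Ep; have [mu [q [mu0 mu1 q1 hb ha]]] := contraction_bounds L.
have q0 : 0 <= q.
  have [ij _] := LG_out hE Ep.
  by have /andP[_] := hb (tag ij); apply: le_trans; exact/ltW/lg_b_gt0.
have [n hn] := exprn_small q0 q1 t0.
elim: n t t0 p Ep hn => [t t0 p Ep|n IH t t0 p Ep hn].
  by rewrite expr0; exists [::].
have [t1|t1] := ltP 1 t; first by exists [::].
have [[i j] [p' [Ep' ep]]] := LG_out hE Ep.
have b0 := lg_b_gt0 i.
have [||w [sw pw]] := IH (t / lg_b i) _ p' Ep'.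
- by rewrite divr_gt0.
- rewrite ltr_pdivlMr//; apply: le_lt_trans hn.
  by rewrite exprSr ler_wpM2l ?exprn_ge0//; have /andP[] := hb i.
exists (i :: w); split=> //=.
by exists j, p'.
Qed.

Lemma stop_lt (t : R) w : stop t w -> height w < t.
Proof.
elim: w t => [t|i w IH t] /=; first by rewrite big_nil.
move=> [_ /IH]; rewrite big_cons ltr_pdivlMr ?lg_b_gt0//.
by rewrite mulrC.
Qed.

Lemma stop_ge (mu t : R) w : 0 <= mu -> (forall i : row, mu <= lg_b i) ->
  t <= 1 -> stop t w -> mu * t <= height w.
Proof.
move=> mu0 hmu; elim: w t => [t t1|i w IH t t1] /=; first by rewrite ltNge t1.
have b0 := lg_b_gt0 i.
rewrite big_cons => -[_]; have [h sw|h] := leP (t / lg_b i) 1.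
  have := IH _ h sw; rewrite -(ler_pM2l b0); apply: le_trans.
  by rewrite mulrCA [_ * (t / _)]mulrC divfK ?gt_eqF.
case: w {IH} => [_|k w [/=]]; last by rewrite leNgt h.
by rewrite big_nil mulr1; have := hmu i; nra.
Qed.

(** Neither stopping word is a prefix of the other, and at their first different letter the rows do
    not overlap. *)
Lemma stop_disjoint (t : R) w w' : stop t w -> stop t w' -> w <> w' ->
  strip_lo w + height w <= strip_lo w' \/
  strip_lo w' + height w' <= strip_lo w.
Proof.
elim: w w' t => [|i w IH] [|i' w'] t //=.
- by move=> t1 [t1']; move: t1; rewrite ltNge t1'.
- by move=> [t1'] _ t1; move: t1; rewrite ltNge t1'.
move=> [_ sw] [_ sw'] ne; rewrite !big_cons.
have [l0 l1] := strip_lo01 w; have [l0' l1'] := strip_lo01 w'.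
have b0 := lg_b_gt0 i; have b0' := lg_b_gt0 i'.
have [ii'|ii'|/ord_inj ii'] := ltngtP i i'.
- by left; have := lg_d_lt ii'; nra.
- by right; have := lg_d_lt ii'; nra.
subst i'; have [//|e|e] := IH w' _ sw sw'; first by move=> e; apply: ne; rewrite e.
  by left; nra.
by right; nra.
Qed.

Lemma two_strips (mu t y1 y2 : R) : 0 <= mu -> (forall i : row, mu <= lg_b i) ->
  0 < t -> t <= 1 -> y2 - y1 < mu * t ->
  exists w1 w2, [/\ stop t w1, stop t w2 & forall p, E p ->
    y1 <= p.2 -> p.2 <= y2 -> strip w1 p \/ strip w2 p].
Proof.
move=> mu0 hmu t0 t1 small; pose V p := [/\ E p, y1 <= p.2 & p.2 <= y2].
have tall w : stop t w -> y2 - y1 < height w.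
  by move=> /(stop_ge mu0 hmu t1); exact: lt_le_trans.
have [p0 Ep0] := LG_neq0 hE; have [w0 [s0 _]] := stop_cover t0 Ep0.
have [[p1 [Ep1 a1 b1]]|no1] := pselect (exists p, V p); last first.
  by exists w0, w0; split=> // p Ep ya yb; case: no1; exists p.
have [w1 [s1 h1]] := stop_cover t0 Ep1.
have [[p2 [[Ep2 a2 b2] nh2]]|no2] := pselect (exists p, V p /\ ~ strip w1 p);
    last first.
  exists w1, w1; split=> // p Ep ya yb; left; apply: contrapT => np.
  by apply: no2; exists p.
have [w2 [s2 h2]] := stop_cover t0 Ep2.
(* Three non-overlapping intervals longer than [y2 - y1] cannot all meet
   [[y1, y2]]: the middle one would be inside it. *)
exists w1, w2; split=> // p Ep ya yb; apply: contrapT => /not_orP[n1 n2].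
have [w3 [s3 h3]] := stop_cover t0 Ep.
have := strip_range h1; have := strip_range h2; have := strip_range h3.
have := tall _ s1; have := tall _ s2; have := tall _ s3.
have [] : [/\ w1 <> w2, w1 <> w3 & w2 <> w3].
  by split=> e; [apply: nh2; rewrite e|apply: n1; rewrite e|apply: n2; rewrite e].
move=> /(stop_disjoint s1 s2) d12 /(stop_disjoint s1 s3) d13.
move=> /(stop_disjoint s2 s3) d23.
by case: d12 => ?; case: d13 => ?; case: d23 => ?; lra.
Qed.

End LGStrips.

(** All four sides are holes wider than the step. The height is confined first, because the lateral
    holes are holes only for points of the band. *)
Lemma chain_in_box (R : realType) (A : set (eplane R))
    (r ee et hl hr vl vr : R) (p z : eplane R) :
  r < ee -> r < et ->
  (forall v, A v -> v.2 <= vl \/ vl + et <= v.2) ->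
  (forall v, A v -> v.2 <= vr \/ vr + et <= v.2) ->
  (forall v, A v -> vl + et <= v.2 -> v.2 <= vr ->
    v.1 <= hl \/ hl + ee <= v.1) ->
  (forall v, A v -> vl + et <= v.2 -> v.2 <= vr ->
    v.1 <= hr \/ hr + ee <= v.1) ->
  chain A r p z ->
  [/\ hl + ee <= p.1, p.1 <= hr, vl + et <= p.2 & p.2 <= vr] ->
  [/\ hl + ee <= z.1, z.1 <= hr, vl + et <= z.2 & z.2 <= vr].
Proof.
move=> re rt hvl hvr hhl hhr pz pbox.
apply: (pz (fun z => [/\ hl + ee <= z.1, z.1 <= hr, vl + et <= z.2 & z.2 <= vr])).
  exact: pbox.
move=> u v Eu Ev [u1 u2 u3 u4] uv.
have := le_trans (edist1 u v) uv; have := le_trans (edist2 u v) uv.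
rewrite !ler_norml => /andP[d1 d2] /andP[d3 d4].
have v4 : v.2 <= vr by case: (hvr v Ev) => // h; lra.
have v3 : vl + et <= v.2 by case: (hvl v Ev) => // h; lra.
split=> //; first by case: (hhl v Ev v3 v4) => // h; lra.
by case: (hhr v Ev v3 v4) => // h; lra.
Qed.

(** * Uniform disconnectedness from row holes and an empty row *)

Section LGDisconnected.
Context {R : realType} (L : LGdata R) (E : set (eplane R)).
Hypothesis hE : lalley_gatzouras_set L E.
Local Notation row := 'I_(lg_m L).
Local Notation full_row := {i : row | (0 < lg_n i)%N}.

Definition row_moran := @moran R row (fun i => 'I_(lg_n i))
  (fun i => @lg_a _ L i) (fun i => @lg_c _ L i).

(** Here [full_row] means a nonempty row, unlike [full_cover]; leaving the empty rows out is what
    creates holes. *)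
Definition height_moran := @moran R unit (fun _ => full_row)
  (fun _ i => lg_b (val i)) (fun _ i => lg_d (val i)).

Lemma strip_row_moran w p : strip E w p -> row_moran w p.1.
Proof.
elim: w p => [p /(LG01_1 hE)//|i w IH p [j [q [/IH qw ->]]]] /=.
by exists j, q.1.
Qed.

Lemma LG_height_moran n p : E p -> height_moran (nseq n tt) p.2.
Proof.
elim: n p => [p /(LG01_2 hE)//|n IH p /(LG_out hE)[[i j] [q [Eq ->]]]] /=.
have i0 : (0 < lg_n i)%N by case: j => j; exact: leq_ltn_trans.
by exists (exist _ i i0), q.2; split=> //; exact: IH.
Qed.

Hypothesis no_full_cover : forall i : row, ~ full_cover i.
Variable i0 : row.
Hypothesis empty_row : lg_n i0 = 0%N.

Lemma common_hole : exists h, [/\ 0 < h, h <= 1,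
  forall i : row, exists g, [/\ 0 <= g, g + h <= 1 &
    forall j : 'I_(lg_n i), lg_c j + lg_a j <= g \/ g + h <= lg_c j] &
  exists g, [/\ 0 <= g, g + h <= 1 &
    forall i : full_row, lg_d (val i) + lg_b (val i) <= g \/ g + h <= lg_d (val i)]].
Proof.
have /choice[f hf] i := row_hole (@no_full_cover i).
have /choice[f' hf'] : forall i : row, exists h, [/\ 0 < h, 0 <= f i,
    f i + h <= 1 &
    forall j : 'I_(lg_n i), lg_c j + lg_a j <= f i \/ f i + h <= lg_c j].
  exact: hf.
have f'0 i : 0 < f' i by have [] := hf' i.
have [h [h0 h1 hh]] := pos_lower_bound f'0.
have b0 := lg_b_gt0 i0; have d1 := lg_db_le1 i0.
(* [lg_b i0] is the length of the vertical hole left by the empty row. *)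
exists (Num.min h (lg_b i0)); split.
- by rewrite lt_min h0.
- by rewrite ge_min h1.
- move=> i; have [_ g0 g1 hg] := hf' i.
  have le : Num.min h (lg_b i0) <= f' i by rewrite ge_min hh.
  by exists (f i); split; [|lra|move=> j; case: (hg j) => ?; [left|right; lra]].
- have le : Num.min h (lg_b i0) <= lg_b i0 by rewrite ge_min lexx orbT.
  exists (lg_d i0); split; [exact: lg_d_ge0|lra|].
  case=> i /= ni; have [ii|ii|/ord_inj ii] := ltngtP i i0.
  + by left; exact: lg_d_lt.
  + by right; have := lg_d_lt ii; lra.
  + by move: ni; rewrite ii empty_row.
Qed.

Lemma LG_chain_bound : exists2 rho : R, 0 < rho & forall s r p z,
  0 < s -> s <= 1 -> r < rho * s -> E p -> chain E r p z -> mdist p z <= 2 * s.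
Proof.
have [mu [q [mu0 mu1 q1 hb ha]]] := contraction_bounds L.
have [h [h0 h1 rowh heighth]] := common_hole.
have a0 (i : row) (j : 'I_(lg_n i)) : mu <= lg_a j <= lg_b i.
  have [_ /ltW -> _] := lg_ab j; rewrite andbT.
  exact: (ha (Tagged (fun i => 'I_(lg_n i)) j)).
have q0 : 0 <= q.
  by have /andP[_] := hb i0; apply: le_trans; exact/ltW/lg_b_gt0.
pose e := h * mu / 3.
have e0 : 0 < e by rewrite divr_gt0// mulr_gt0.
have hm1 : h * mu <= 1 by rewrite mulr_ile1// ltW.
have e1 : e <= 1 / 3 by rewrite /e; lra.
have three s : s <= 3 -> s <= 3 / mu.
  move=> s3; rewrite ler_pdivlMr//; have [s0|s0] := leP 0 s; nra.
have hole1 (w : seq row) u s : 0 < s -> s <= 1 ->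
    3 * \prod_(i <- w) lg_b i < mu * s -> exists g, [/\ u <= g, g + e * s <= u + s &
      forall z, strip E w z -> z.1 <= g \/ g + e * s <= z.1].
  move=> s0 s1 hw.
  have [|||||g [g1 g2 g3]] := @moran_hole R row (fun i => 'I_(lg_n i))
    (fun i => @lg_a _ L i) (fun i => @lg_c _ L i) (fun i => lg_b i) mu h
    mu0 mu1 h0 h1 a0 _ _ _ w u s s0.
  - by move=> i j; split; [exact: lg_c_ge0|exact: lg_ca_le1].
  - move=> i j k; have [jk|jk|/ord_inj jk] := ltngtP j k.
    + by apply: Or32; exact: lg_c_lt.
    + by apply: Or33; exact: lg_c_lt.
    + exact: Or31.
  - exact: rowh.
  - by apply: three; lra.
  - exact: hw.
  by exists g; split=> // z /strip_row_moran /g3.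
have hole2 u s : 0 < s -> s <= 1 -> exists g, [/\ u <= g, g + e * s <= u + s &
    forall z, E z -> z.2 <= g \/ g + e * s <= z.2].
  move=> s0 s1.
  have ms : 0 < mu * s / 3 by rewrite divr_gt0// mulr_gt0.
  have [n hn] := exprn_small q0 q1 ms.
  have [||||||g [g1 g2 g3]] := @moran_hole R unit (fun _ => full_row)
    (fun _ i => lg_b (val i)) (fun _ i => lg_d (val i)) (fun _ => q) mu h
    mu0 mu1 h0 h1 _ _ _ _ (nseq n tt) u s s0.
  - by move=> _ i; exact: hb.
  - by move=> _ i; split; [exact: lg_d_ge0|exact: lg_db_le1].
  - move=> _ i j; have [ij|ij|/ord_inj/val_inj ij] := ltngtP (val i) (val j).
    + by apply: Or32; exact: lg_d_lt.
    + by apply: Or33; exact: lg_d_lt.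
    + exact: Or31.
  - by move=> _; exact: heighth.
  - by apply: three; lra.
  - rewrite big_nseq iter_mulr_1; lra.
  by exists g; split=> // z /(LG_height_moran n) /g3.
(* Strips of height below [ka * s] are thin enough to have holes at scale [e * s]. *)
pose ka := mu * e / 3.
have ka0 : 0 < ka by rewrite divr_gt0// mulr_gt0.
have ka1 : ka <= 1 / 9 by rewrite /ka; nra.
(* The band of height [2 * tau0 * s] is lower than [mu * (ka * s)], so at most two strips are
   needed. *)
pose tau0 := mu * ka / 3.
have tau00 : 0 < tau0 by rewrite divr_gt0// mulr_gt0.
have tau01 : tau0 <= 1 / 27 by rewrite /tau0; nra.
(* The relative widths of the lateral and of the horizontal sides of the box. *)
exists (Num.min (e * e) (e * tau0)).
  by rewrite lt_min; apply/andP; split; exact: mulr_gt0.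
move=> s r p z s0 s1 rs Ep pz.
have [r1 r2] : r < e * (e * s) /\ r < e * (tau0 * s).
  split; apply: lt_le_trans rs _; rewrite [leRHS]mulrA ler_pM2r//.
    by rewrite ge_min lexx.
  by rewrite ge_min lexx orbT.
pose t := ka * s; pose tau := tau0 * s.
have t0 : 0 < t by rewrite mulr_gt0.
have t1 : t <= 1 by rewrite /t; nra.
have tau_gt0 : 0 < tau by rewrite mulr_gt0.
have tau_le1 : tau <= s by rewrite /tau; nra.
have [|w1 [w2 [s_w1 s_w2 cover]]] := @two_strips R L E hE mu t
  (p.2 - tau) (p.2 + tau) (ltW mu0) (fun i => proj1 (andP (hb i))) t0 t1.
  by have := mulr_gt0 mu0 t0; rewrite /tau /tau0 /t; lra.
have [vr [vr1 vr2 vr3]] := hole2 p.2 tau tau_gt0 (le_trans tau_le1 s1).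
have [vl [vl1 vl2 vl3]] := hole2 (p.2 - tau) tau tau_gt0 (le_trans tau_le1 s1).
have es0 : 0 < e * s by rewrite mulr_gt0.
have es1 : e * s <= s by nra.
have thin (w : seq row) : stop t w -> 3 * \prod_(i <- w) lg_b i < mu * (e * s).
  by move=> /stop_lt; rewrite /t /ka; lra.
have {}r2 : r < e * tau by [].
clearbody tau t tau0 ka e; clear rowh heighth hm1 e1 ka1 tau01 rs t1 q1 mu1 h1.
(* A hole common to both strips: a hole of the second, found at scale [e * s] inside a hole of the
   first. *)
have hole12 u : exists g, [/\ u <= g, g + e * (e * s) <= u + s &
    forall z, strip E w1 z \/ strip E w2 z ->
      z.1 <= g \/ g + e * (e * s) <= z.1].
  have thin1 : 3 * \prod_(i <- w1) lg_b i < mu * s.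
    by apply: lt_le_trans (thin _ s_w1) _; rewrite ler_pM2l.
  have [g [g1 g2 g3]] := hole1 w1 u s s0 s1 thin1.
  have [g' [g1' g2' g3']] := hole1 w2 g (e * s) es0 (le_trans es1 s1) (thin _ s_w2).
  exists g'; split; [lra|lra|move=> x [/g3 [|]|/g3' //]].
  - by left; lra.
  - by right; lra.
have [hr [hr1 hr2 hr3]] := hole12 p.1.
have [hl [hl1 hl2 hl3]] := hole12 (p.1 - s).
have et0 : 0 < e * tau by rewrite mulr_gt0.
have ee0 : 0 < e * (e * s) by rewrite mulr_gt0.
move: (e * tau) (e * (e * s)) r1 r2 vr2 vr3 vl2 vl3 hr2 hr3
  hl2 hl3 et0 ee0 => et ee r1' r2' vr2 vr3 vl2 vl3 hr2 hr3 hl2 hl3 et0 ee0.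
have vcover v : E v -> vl + et <= v.2 -> v.2 <= vr -> strip E w1 v \/ strip E w2 v.
  by move=> Ev v1 v2; apply: cover => //; lra.
have [|||z1 z2 z3 z4] :=
  @chain_in_box R E r ee et hl hr vl vr p z r1' r2' vl3 vr3 _ _ pz.
- by move=> v Ev v1 v2; exact/hl3/vcover.
- by move=> v Ev v1 v2; exact/hr3/vcover.
- by split; lra.
apply: le_trans (edist_le _ _) _.
have : `|p.1 - z.1| <= s by rewrite ler_norml; apply/andP; split; lra.
have : `|p.2 - z.2| <= tau by rewrite ler_norml; apply/andP; split; lra.
lra.
Qed.

Theorem LG_unif_disconnected : unif_disconnected E.
Proof.
have [rho rho0 hrho] := LG_chain_bound.
(* With [s = mdist x y / 3] a chain would give [mdist x y <= 2 / 3 * mdist x y]; the step lies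
   strictly below [rho * s]. *)
exists (rho / 6); first by rewrite divr_gt0.
move=> x y Ex Ey nxy xy.
have D0 : 0 < mdist x y by rewrite mdist_gt0; apply/eqP.
have D2 := square_diam (LG01 hE) Ex Ey.
have rD0 : 0 < rho * mdist x y by rewrite mulr_gt0.
have : mdist x y <= 2 * (mdist x y / 3).
  apply: (hrho _ (rho / 6 * mdist x y)) => //; last lra.
    by rewrite divr_gt0.
  lra.
lra.
Qed.

End LGDisconnected.

(** * Full rows and empty rows *)

Section LGSegment.
Context {R : realType} (L : LGdata R) (E : set (eplane R)).
Hypothesis hE : lalley_gatzouras_set L E.
Local Notation row := 'I_(lg_m L).

Lemma LG_closed p : (forall e : R, 0 < e -> exists2 x, E x & mdist p x < e) -> E p.
Proof.
move=> h; have : closed E.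
  by apply: compact_closed (LG_compact hE); exact: metric_hausdorff.
move=> /closure_id ->; move=> B; rewrite -nbhs_ballE => -[e /= e0 eB].
by have [x Ex px] := h e e0; exists x; split=> //; apply: eB; rewrite ballEmdist.
Qed.

(** All columns of row [i] share one vertical map, with fixed point [y]. Pulling [x] back through
    [n] columns and pushing a point of [E] forward lands within [q ^+ n] of [(x, y)] in each
    coordinate, and [E] is closed. *)
Lemma full_cover_segment (i : row) : full_cover i ->
  exists y, forall x : R, 0 <= x < 1 -> E (x, y).
Proof.
move=> full; have [mu [q [mu0 mu1 q1 hb ha]]] := contraction_bounds L.
have b0 := lg_b_gt0 i; have b1 := lg_b_lt1 i.
have /andP[_ bq] := hb i; have q0 : 0 < q by exact: lt_le_trans bq.
pose y := lg_d i / (1 - lg_b i).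
have ey : lg_b i * y + lg_d i = y by rewrite /y; field; lra.
have y0 : 0 <= y by rewrite divr_ge0 ?lg_d_ge0// subr_ge0 ltW.
have y1 : y <= 1.
  by rewrite ler_pdivrMr; have := lg_db_le1 i; lra.
have [p0 Ep0] := LG_neq0 hE; have /andP[/andP[p1 p2] /andP[p3 p4]] := LG01 hE Ep0.
have approx n (x : R) : 0 <= x < 1 -> exists p, [/\ E p,
    `|x - p.1| <= q ^+ n & `|y - p.2| <= q ^+ n].
  elim: n x => [|n IH] x /andP[x0 x1].
    by exists p0; rewrite expr0 !ler_norml; split=> //; apply/andP; split; lra.
  have [|j /andP[cx xc]] := full x; first by rewrite x0.
  have [a0 ab _] := lg_ab j.
  have [|p [Ep h1 h2]] := IH ((x - lg_c j) / lg_a j).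
    apply/andP; split; last by rewrite ltr_pdivrMr// mul1r; lra.
    by apply: divr_ge0; [rewrite subr_ge0|exact: ltW].
  exists (lg_S (Tagged (fun i => 'I_(lg_n i)) j) p); split.
  - exact: LG_in.
  - have -> : x - (lg_S (Tagged (fun i => 'I_(lg_n i)) j) p).1 =
        lg_a j * ((x - lg_c j) / lg_a j - p.1).
      by rewrite mulrBr mulrC divfK ?gt_eqF// lg_S1 /Da /Dc /=; ring.
    rewrite normrM gtr0_norm// exprS ler_pM//; first exact: ltW.
    exact/ltW/(lt_le_trans ab bq).
  - have -> : y - (lg_S (Tagged (fun i => 'I_(lg_n i)) j) p).2 =
        lg_b i * (y - p.2).
      by rewrite -{1}ey lg_S2 /Db /Dd /=; ring.
    by rewrite normrM gtr0_norm// exprS ler_pM// ltW.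
exists y => x x01; apply: LG_closed => e e0.
have e20 : 0 < e / 2 by rewrite divr_gt0.
have [n hn] := exprn_small (ltW q0) q1 e20.
have [p [Ep h1 h2]] := approx n x x01; exists p => //.
by apply: le_lt_trans (edist_le _ _) _ => /=; lra.
Qed.

Lemma totally_disconnected_no_full_cover (i : row) :
  totally_disconnected E -> ~ full_cover i.
Proof.
move=> td /full_cover_segment[y hy].
pose f (x : R) : eplane R := (x, y).
have df (x x' : R) : mdist (f x) (f x') = `|x - x'|.
  by rewrite edistE /Defs.edist /= subrr expr0n addr0 sqrtr_sqr.
have cf : continuous f.
  move=> x B; rewrite -nbhs_ballE => -[e /= e0 eB].
  have : nbhs x (ball x e) by exact: nbhsx_ballx.
  apply: filterS => x'; rewrite /ball/= => xx'.
  by apply: eB; rewrite ballEmdist/= df.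
have half : (0 : R) <= 1 / 2 by lra.
have E0 : E (f 0) by apply: hy; rewrite lexx ltr01.
have : connected_component E (f 0) (f (1 / 2)).
  (* Half of the segment suffices and avoids its end 1, which the covering leaves out. *)
  exists (f @` [set` `[0 : R, 1 / 2]]); last first.
    by exists (1 / 2) => //; rewrite /= in_itv/= lexx half.
  split.
  - by exists 0 => //; rewrite /= in_itv/= lexx half.
  - move=> _ [x + <-]; rewrite /= in_itv/= => /andP[x0 x1].
    by apply: hy; apply/andP; split; lra.
  - apply: connected_continuous_connected; first exact: segment_connected.
    exact: continuous_subspaceT.
by rewrite (td _ E0) /= => -[]; lra.
Qed.

End LGSegment.

(** Steps short relative to [mdist x y] have images too short to leave a ternary cylinder that
    contains the image of [x] but not that of [y]. *)
Lemma qs_cantor_unif_disconnected (R : realType) (X : metricType R)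
    (A : set X) :
  qs_equivalent (set_type A) (set_type (@cantor_ternary R)) ->
  unif_disconnected A.
Proof.
move=> [f [[finj [eta [[g [[_ gf _ fg] _]] qs]]] _]].
have valC (u : set_type (@cantor_ternary R)) : cantor_ternary (set_val u).
  exact: set_valP.
(* [g] takes distinct values at 1/12 and 1/13, so one of them is positive. *)
have [t t0 et] : exists2 t : R, 0 < t & eta t <= 1 / 12.
  have in0 (u : R) : 0 <= u -> u \in [set` `[0, +oo[ : interval R].
    by move=> u0; rewrite inE/= in_itv/= andbT.
  have g_ge0 (u : R) : 0 <= u -> 0 <= g u.
    by move=> /in0/set_mem/gf; rewrite /= in_itv/= andbT.
  have [h1 h2] : (0 : R) <= 1 / 12 /\ (0 : R) <= 1 / 13 by split; lra.
  have [g0|g0] := eqVneq (g (1 / 12)) 0; last first.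
    by exists (g (1 / 12)); [rewrite lt_def g0 g_ge0|rewrite fg ?in0].
  exists (g (1 / 13)); last by rewrite fg ?in0//; lra.
  rewrite lt_def g_ge0// andbT; apply/eqP => g1.
  have := fg _ (in0 _ h1); have := fg _ (in0 _ h2); rewrite g0 g1 => ->; lra.
exists (t / 2); first by rewrite divr_gt0.
move=> x y Ax Ay nxy xy.
pose x' : set_type A := exist _ x (mem_set Ax).
pose y' : set_type A := exist _ y (mem_set Ay).
pose F (u : set_type A) : R^o := set_val (f u).
have CF u : cantor_ternary (F u) by exact: valC.
have nF : ~ (tdigit (F x') =1 tdigit (F y')).
  move=> /(tdigit_inj (CF x') (CF y'))/val_inj/finj e.
  by apply: nxy; exact: (congr1 set_val e).
have [n [an dn]] := first_difference nF.
(* Invariant along the chain: the image shares its first [n.+1] digits with [F x']. *)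
have [w [ew hw]] : exists w : set_type A, set_val w = y /\
    forall m, (m < n.+1)%N -> tdigit (F w) m = tdigit (F x') m.
  apply: (xy (fun u => exists w : set_type A, set_val w = u /\
    forall m, (m < n.+1)%N -> tdigit (F w) m = tdigit (F x') m)).
    by exists x'.
  move=> _ v _ Av [u [<- hu]] uv; pose v' : set_type A := exist _ v (mem_set Av).
  exists v'; split=> // m mn; rewrite -hu//; apply/esym.
  apply: (cantor_close (CF u) (CF v') _ mn).
  have i0 : 0 < 3^-1 ^+ n :> R by rewrite exprn_gt0// invr_gt0.
  have near_x : mdist (F u) (F x') <= 3^-1 ^+ n.+1.
    exact: cantor_dist_ub (CF _) (CF _) hu.
  have xy_near : mdist (F x') (F y') <= 3^-1 ^+ n.
    exact: cantor_dist_ub (CF _) (CF _) an.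
  have tri1 := @metric_triangle R R^o (F u) (F x') (F y').
  have tri2 := @metric_triangle R X x (set_val u) y.
  rewrite [mdist x (set_val u)]metric_sym in tri2.
  rewrite exprS in near_x *.
  (* The farther of [x] and [y] is at least [mdist x y / 2] from [u], so the step is at most [t]
     times that distance. Its image is at most [1 / 12] of [3^-1 ^+ n.+1 + 3^-1 ^+ n], below
     [3^-1 ^+ n.+1]. *)
  have [h|h] := leP (mdist (set_val u) y) (mdist (set_val u) x).
    have step : mdist u v' <= t * mdist u x'.
      apply: (le_trans uv).
      rewrite -[mdist u x']/(mdist (set_val u) x); nra.
    have := qs _ _ _ _ t0 step.
    rewrite -[mdist (f u) (f v')]/(mdist (F u) (F v')).
    rewrite -[mdist (f u) (f x')]/(mdist (F u) (F x')).
    have := mdist_ge0 (F u) (F x'); nra.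
  have step : mdist u v' <= t * mdist u y'.
    apply: (le_trans uv).
    rewrite -[mdist u y']/(mdist (set_val u) y); nra.
  have := qs _ _ _ _ t0 step.
  rewrite -[mdist (f u) (f v')]/(mdist (F u) (F v')).
  rewrite -[mdist (f u) (f y')]/(mdist (F u) (F y')).
  have := mdist_ge0 (F u) (F y'); nra.
apply: dn; have -> : y' = w by apply: val_inj; exact: esym ew.
by rewrite hw.
Qed.

(** * Without empty rows, thin cylinders violate uniform disconnectedness *)

Section LGThinColumns.
Context {R : realType} (L : LGdata R) (E : set (eplane R)).
Hypothesis hE : lalley_gatzouras_set L E.
Local Notation row := 'I_(lg_m L).

Lemma rows_cover (y : R) : 0 <= y < 1 ->
  exists i : row, lg_d i <= y < lg_d i + lg_b i.
Proof.
move=> /andP[y0 y1].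
have step k : (k <= lg_m L)%N -> y < \sum_(l < lg_m L | (l < k)%N) lg_b l ->
    exists i : row, lg_d i <= y < lg_d i + lg_b i.
  elim: k => [_|k IH km yk]; first by rewrite big_pred0// ltNge y0.
  have [h|h] := ltP y (lg_d (Ordinal km)); first exact: IH (ltnW km) h.
  by exists (Ordinal km); rewrite h lg_db.
apply: (step _ (leqnn _)); apply: lt_le_trans y1 _.
by rewrite -(lg_b_sum1 L); apply: sum_b_le => i _.
Qed.

Hypothesis full_rows : forall i : row, (0 < lg_n i)%N.

Lemma heights_dense (y e : R) : 0 <= y < 1 -> 0 < e ->
  exists2 p, E p & `|y - p.2| <= e.
Proof.
move=> y01 e0; have [mu [q [mu0 mu1 q1 hb ha]]] := contraction_bounds L.
have [p0 Ep0] := LG_neq0 hE; have /andP[p1 p2] := LG01_2 hE Ep0.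
have q0 : 0 <= q.
  have [ij _] := LG_out hE Ep0.
  by have /andP[_] := hb (tag ij); apply: le_trans; exact/ltW/lg_b_gt0.
have approx n (z : R) : 0 <= z < 1 ->
    exists2 p, E p & `|z - p.2| <= q ^+ n.
  elim: n z => [|n IH] z z01.
    exists p0 => //; have /andP[z0 z1] := z01.
    by rewrite expr0 ler_norml; apply/andP; split; lra.
  have [i /andP[dz zd]] := rows_cover z01.
  have b0 := lg_b_gt0 i; have /andP[_ bq] := hb i.
  have [|p Ep hp] := IH ((z - lg_d i) / lg_b i).
    apply/andP; split; last by rewrite ltr_pdivrMr// mul1r; lra.
    by apply: divr_ge0; [rewrite subr_ge0|exact: ltW].
  exists (lg_S (Tagged (fun i => 'I_(lg_n i)) (Ordinal (full_rows i))) p).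
    exact: LG_in.
  rewrite lg_S2 /Db /Dd /=.
  have -> : z - (lg_b i * p.2 + lg_d i) = lg_b i * ((z - lg_d i) / lg_b i - p.2).
    by rewrite mulrBr [lg_b i * (_ / _)]mulrC divfK ?gt_eqF//; ring.
  by rewrite normrM gtr0_norm// exprS ler_pM// ltW.
have [n hn] := exprn_small q0 q1 e0.
by have [p Ep hp] := approx n y y01; exists p => //; apply: le_trans hp (ltW hn).
Qed.

Lemma full_rows_not_unif_disconnected : ~ unif_disconnected E.
Proof.
move=> [k k0 hk].
have [ij _] := LG_out hE (proj2_sig (cid (LG_neq0 hE))).
pose a := Da ij; pose b := Db ij.
have a0 : 0 < a := Da_gt0 ij; have b0 : 0 < b := Db_gt0 ij.
have ab : a < b := Da_lt_Db ij.
pose T n := iter n (lg_S ij).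
have T1 n p q : (T n p).1 - (T n q).1 = a ^+ n * (p.1 - q.1).
  elim: n => [|n IH]; first by rewrite expr0 mul1r.
  rewrite /T !iterS !lg_S1 opprD addrACA subrr addr0 -mulrBr -/(T n) IH exprS.
  by rewrite mulrA.
have T2 n p q : (T n p).2 - (T n q).2 = b ^+ n * (p.2 - q.2).
  elim: n => [|n IH]; first by rewrite expr0 mul1r.
  rewrite /T !iterS !lg_S2 opprD addrACA subrr addr0 -mulrBr -/(T n) IH exprS.
  by rewrite mulrA.
have ET n p : E p -> E (T n p).
  by move=> Ep; elim: n => [//|n IH]; rewrite /T iterS; exact: LG_in.
(* [12 / k] makes the vertical steps [3 * dl] at most [k / 8]; 4 makes the endpoint errors [2 * dl]
   at most [1 / 4]. *)
have [N N4 Nk] : exists2 N : nat, (4 <= N)%N & 12 / k <= N%:R.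
  exists (4 + Num.bound (12 / k))%N; first exact: leq_addr.
  have k12 : 0 <= 12 / k by rewrite divr_ge0// ltW.
  by rewrite natrD; have := archi_boundP k12; lra.
have N0 : 0 < N%:R :> R by rewrite ltr0n; exact: leq_trans N4.
have N4' : 4 <= N%:R :> R by rewrite ler_nat.
pose dl : R := 1 / (2 * N%:R).
have dl0 : 0 < dl by rewrite divr_gt0// mulr_gt0.
have Ndl : N%:R * dl = 1 / 2 by rewrite /dl; field; rewrite gt_eqF.
have dl8 : dl <= 1 / 8 by nra.
have dlk : 3 * dl <= k / 8.
  rewrite ler_pdivrMr// in Nk.
  have : 12 * dl <= N%:R * dl * k by rewrite mulrAC ler_pM2r.
  by rewrite Ndl; lra.
(* After [n] iterations the cylinder is so thin that horizontal moves cost at most [k / 8] of its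
   height scale [b ^+ n]. *)
have [n hn] : exists n, (a / b) ^+ n < k / 8.
  by apply: exprn_small; [rewrite divr_ge0// ltW|rewrite ltr_pdivrMr// mul1r|
    rewrite divr_gt0].
have bn0 : 0 < b ^+ n by rewrite exprn_gt0.
have an : a ^+ n <= k / 8 * b ^+ n.
  by rewrite -ler_pdivrMr// -expr_div_n ltW.
pose r := k * (b ^+ n / 4).
have step p q : E p -> E q -> `|p.2 - q.2| <= 3 * dl ->
    mdist (T n p) (T n q) <= r.
  move=> Ep Eq pq; apply: le_trans (edist_le _ _) _.
  have p1q : `|p.1 - q.1| <= 1.
    have /andP[? ?] := LG01_1 hE Ep; have /andP[? ?] := LG01_1 hE Eq.
    by rewrite ler_norml; apply/andP; split; lra.
  rewrite T1 T2 !normrM [`|a ^+ n|]gtr0_norm ?exprn_gt0// [`|b ^+ n|]gtr0_norm//.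
  have h1 : a ^+ n * `|p.1 - q.1| <= k / 8 * b ^+ n.
    by apply: le_trans an; rewrite ler_piMr// exprn_ge0// ltW.
  have h2 : b ^+ n * `|p.2 - q.2| <= k / 8 * b ^+ n.
    by rewrite mulrC ler_pM2r//; exact: le_trans pq dlk.
  by rewrite /r; lra.
have [p0 Ep0 hp0] : exists2 p, E p & `|0 * dl - p.2| <= dl.
  by apply: heights_dense; rewrite ?mul0r ?lexx ?ltr01.
(* The chain climbs in [N] steps from height about 0 to height about [1 / 2], before mapping into
   the thin cylinder. *)
have climb m : (m <= N)%N -> exists p,
    [/\ E p, `|m%:R * dl - p.2| <= dl & chain E r (T n p0) (T n p)].
  elim: m => [_|m IH mN]; first by exists p0; split=> //; exact: chain_refl.
  have [p [Ep hp cp]] := IH (ltnW mN).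
  have [||p' Ep' hp'] := @heights_dense (m.+1%:R * dl) dl.
  - rewrite mulr_ge0 ?ltW//=; apply: (@le_lt_trans _ _ (1 / 2)); last lra.
    by rewrite -Ndl ler_pM2r// ler_nat.
  - exact: dl0.
  exists p'; split=> //; apply: chain_trans cp _; apply: chain_step; try exact: ET.
  apply: step => //; move: hp hp'; rewrite -natr1 mulrDl mul1r !ler_norml.
  by move=> /andP[h1 h2] /andP[h3 h4]; apply/andP; split; lra.
have [p [Ep hp cp]] := climb N (leqnn N).
have far : b ^+ n / 4 <= mdist (T n p0) (T n p).
  apply: le_trans (edist2 _ _); rewrite T2 normrM gtr0_norm// ler_pM2l//.
  move: hp hp0; rewrite Ndl mul0r !ler_norml => /andP[h1 h2] /andP[h3 h4].
  by rewrite ler_normr; apply/orP; right; lra.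
apply: (hk (T n p0) (T n p)); [exact: ET|exact: ET| |].
  move=> e; move: far; rewrite e mdistxx; apply/negP; rewrite -ltNge.
  by rewrite divr_gt0.
by apply: chain_le cp; rewrite /r ler_pM2l.
Qed.

End LGThinColumns.

(** With a single map [E] is one point: totally disconnected, with an empty row as there are at
    least two rows, yet not equivalent to the Cantor set. [hD] excludes this case and supplies the
    two points behind uniform perfectness. *)
Theorem corollary1p2 (R : realType) (L : LGdata R) (E : set (eplane R))
    (hE : lalley_gatzouras_set L E)
    (hD : (1 < #|lg_D L|)%N) :
  qs_equivalent (set_type E) (set_type (@cantor_ternary R)) <->
  totally_disconnected E /\ exists i : 'I_(lg_m L), lg_n i = 0%N.
Proof.
split=> [/qs_cantor_unif_disconnected ud|[td [i ni]]].
  split; first exact: unif_disconnected_totally.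
  apply: contrapT => noempty; apply: (full_rows_not_unif_disconnected hE _ ud).
  by move=> i; rewrite lt0n; apply/eqP => ni; apply: noempty; exists i.
apply: plane_qs_cantor.
- exact: LG01 hE.
- exact: LG_compact hE.
- by have [p Ep] := LG_neq0 hE; exists p.
- apply: (LG_unif_disconnected hE _ ni) => k.
  exact: (totally_disconnected_no_full_cover hE td).
- exact: (LG_unif_perfect hE hD).
Qed.
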